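(* The following three definitions of the dyadic space $\mathrm{VMO}_d(\mathbb{R})$ are equivalent (they define the same subspace of $\mathrm{BMO}_d(\mathbb{R})$). (1) $\mathrm{VMO}_d(\mathbb{R})$ is the closure of $C_0^\infty(\mathbb{R})$ in the $\mathrm{BMO}_d(\mathbb{R})$ norm. (2) $\mathrm{VMO}_d(\mathbb{R})$ is the set of all $f\in\mathrm{BMO}_d(\mathbb{R})$ such that (a) $\lim_{\varepsilon\to0}\sup_{I\in\mathcal{D},\,|I|<\varepsilon}\frac1{|I|}\int_I|f-f_I|\,dx=0$; (b) $\lim_{N\to\infty}\sup_{I\in\mathcal{D},\,|I|>N}\frac1{|I|}\int_I|f-f_I|\,dx=0$; and (c) $\lim_{R\to\infty}\sup_{I\in\mathcal{D},\,I\cap B(0,R)=\emptyset}\frac1{|I|}\int_I|f-f_I|\,dx=0$. (3) $\mathrm{VMO}_d(\mathbb{R})$ is the set of all $f\in\mathrm{BMO}_d(\mathbb{R})$ such that (a) $\lim_{\varepsilon\to0}\sup_{J\in\mathcal{D}}\frac1{|J|}\sum_{I\in\mathcal{D},\,I\subset J,\,|I|<\varepsilon}(f,h_I)^2=0$; (b) $\lim_{N\to\infty}\sup_{J\in\mathcal{D}}\frac1{|J|}\sum_{I\in\mathcal{D},\,I\subset J,\,|I|>N}(f,h_I)^2=0$; and (c) $\lim_{R\to\infty}\sup_{J\in\mathcal{D}}\frac1{|J|}\sum_{I\in\mathcal{D},\,I\subset J,\,I\cap B(0,R)=\emptyset}(f,h_I)^2=0$.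
   Context: $\mathcal{D}=\{[k2^{-n},(k+1)2^{-n}): n,k\in\mathbb{Z}\}$ is the grid of dyadic intervals in $\mathbb{R}$. $f_I=\frac1{|I|}\int_If$. $\mathrm{BMO}_d(\mathbb{R})$ is the space of $f\in L^1_{\mathrm{loc}}(\mathbb{R})$ with $\|f\|_{\mathrm{BMO}_d(\mathbb{R})}=\sup_{I\in\mathcal{D}}\frac1{|I|}\int_I|f-f_I|\,dx<\infty$ (a seminorm). $C_0^\infty(\mathbb{R})$ denotes smooth compactly supported functions. $B(0,R)=(-R,R)$. $h_I=|I|^{-1/2}(\chi_{I_r}-\chi_{I_l})$ is the Haar function of $I$, with $I_l,I_r$ the left and right halves of $I$, and $(f,h_I)=\int fh_I$. *)

(* Defs.v *)
From mathcomp Require Import all_boot all_order all_algebra.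
From mathcomp Require Import all_classical all_reals all_analysis.

Set Implicit Arguments.
Unset Strict Implicit.
Unset Printing Implicit Defensive.
Import Order.TTheory GRing.Theory Num.Theory.
Import numFieldNormedType.Exports.

Local Open Scope classical_set_scope.
Local Open Scope ring_scope.

Section dyadic_grid.
Variable R : realType.
Local Notation mu := (@lebesgue_measure R).

(* The pair (n, k) stands for the dyadic interval [k 2^-n, (k+1) 2^-n[;
   [dyadic_interval_inj] below shows that this indexing of the grid is faithful. *)
Local Notation dyadic_index := (int * int)%type.

Definition dyadic_interval (I : dyadic_index) : set R :=
  `[I.2%:~R * 2 ^ (- I.1), (I.2 + 1)%:~R * 2 ^ (- I.1)[%classic.

Definition dyadic_left (I : dyadic_index) : dyadic_index :=
  (I.1 + 1, 2 * I.2).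
Definition dyadic_right (I : dyadic_index) : dyadic_index :=
  (I.1 + 1, 2 * I.2 + 1).

Definition dyadic_length (I : dyadic_index) : R := fine (mu (dyadic_interval I)).

Definition dyadic_mean (f : R -> R) (I : dyadic_index) : R :=
  (dyadic_length I)^-1 * \int[mu]_(x in dyadic_interval I) f x.

(* [iavg g A] is |A|^-1 * \int_A |g|, as an extended real *)
Definition mean_osc (f : R -> R) (I : dyadic_index) : \bar R :=
  iavg (fun x => f x - dyadic_mean f I) (dyadic_interval I).

Definition haar (I : dyadic_index) (x : R) : R :=
  (Num.sqrt (dyadic_length I))^-1 *
  (\1_(dyadic_interval (dyadic_right I)) x - \1_(dyadic_interval (dyadic_left I)) x).

Definition haar_coef (f : R -> R) (I : dyadic_index) : R :=
  \int[mu]_(x in [set: R]) (f x * haar I x).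

Definition haar_energy (f : R -> R) (P : set dyadic_index)
    (J : dyadic_index) : \bar R :=
  ((dyadic_length J)^-1%:E *
   \esum_(I in [set I | dyadic_interval I `<=` dyadic_interval J] `&` P)
     ((haar_coef f I) ^+ 2)%:E)%E.

Definition bmo_norm (f : R -> R) : \bar R :=
  ereal_sup [set mean_osc f I | I in [set: dyadic_index]].

Definition BMO : set (R -> R) :=
  [set f | locally_integrable [set: R] f /\ (bmo_norm f < +oo)%E].

Definition test_function : set (R -> R) :=
  [set f | (forall n x, derivable (derive1n n f) x 1) /\
           compact (closure [set x | f x != 0])].

Definition short_dyadic (e : R) : set dyadic_index :=
  [set I | dyadic_length I < e].
Definition long_dyadic (N : R) : set dyadic_index :=
  [set I | N < dyadic_length I].
Definition far_dyadic (r : R) : set dyadic_index :=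
  [set I | dyadic_interval I `&` `]- r, r[%classic = set0].

(* [bmo_norm] is a seminorm, vanishing on functions constant on each half-line;
   the closure is taken in BMO for this seminorm. *)
Definition VMO_closure : set (R -> R) :=
  [set f | BMO f /\ forall e : R, 0 < e ->
     exists2 g, test_function g & (bmo_norm (f \- g)%R < e%:E)%E].

Definition VMO_osc : set (R -> R) :=
  [set f | [/\ BMO f,
     ereal_sup [set mean_osc f I | I in short_dyadic e] @[e --> 0^'+] --> 0%E,
     ereal_sup [set mean_osc f I | I in long_dyadic N] @[N --> +oo] --> 0%E &
     ereal_sup [set mean_osc f I | I in far_dyadic r] @[r --> +oo] --> 0%E]].

Definition VMO_haar : set (R -> R) :=
  [set f | [/\ BMO f,
     ereal_sup [set haar_energy f (short_dyadic e) J | J in [set: dyadic_index]]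
       @[e --> 0^'+] --> 0%E,
     ereal_sup [set haar_energy f (long_dyadic N) J | J in [set: dyadic_index]]
       @[N --> +oo] --> 0%E &
     ereal_sup [set haar_energy f (far_dyadic r) J | J in [set: dyadic_index]]
       @[r --> +oo] --> 0%E]].

Lemma dyadic_interval_lt (I : dyadic_index) :
  I.2%:~R * 2 ^ (- I.1) < (I.2 + 1)%:~R * 2 ^ (- I.1) :> R.
Proof. by rewrite ltr_pM2r ?exprz_gt0// ltr_int ltrDl. Qed.

Lemma dyadic_lengthE (I : dyadic_index) : dyadic_length I = 2 ^ (- I.1).
Proof.
rewrite /dyadic_length /dyadic_interval lebesgue_measure_itv/= lte_fin.
by rewrite dyadic_interval_lt/= -mulrBl -intrB addrAC subrr add0r mul1r.
Qed.

Lemma dyadic_interval_inj : injective dyadic_interval.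
Proof.
move=> I J IJ.
have e1 : 2 ^ (- I.1) = 2 ^ (- J.1) :> R.
  by rewrite -!dyadic_lengthE /dyadic_length IJ.
have e2 : I.2%:~R * 2 ^ (- I.1) = J.2%:~R * 2 ^ (- J.1) :> R.
  have := congr1 inf IJ; rewrite /dyadic_interval.
  by rewrite !inf_itv//= bnd_simp dyadic_interval_lt.
have two1 : (1 : R) < 2 by rewrite ltr1n.
have n1 : I.1 = J.1.
  by apply: oppr_inj; apply: (ieexprIz _ _ e1) => //; rewrite gt_eqF.
move: e2; rewrite e1 => /mulIf; rewrite expfz_neq0// => /(_ isT)/intr_inj.
by case: I J n1 {IJ e1} => [a b] [c d] /= -> ->.
Qed.

Lemma dyadic_halves (I : dyadic_index) :
  dyadic_interval I = dyadic_interval (dyadic_left I) `|` dyadic_interval (dyadic_right I).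
Proof.
have h : 2 ^ (- I.1) = 2 * 2 ^ (- (I.1 + 1)) :> R.
  by rewrite opprD expfzDr// mulrCA mulfV// mulr1.
rewrite /dyadic_interval /= h !mulrA.
rewrite (_ : I.2%:~R * 2 = (2 * I.2)%:~R :> R); last by rewrite intrM mulrC.
rewrite (_ : (I.2 + 1)%:~R * 2 = (2 * I.2 + 1 + 1)%:~R :> R); last first.
  by rewrite -addrA (_ : 1 + 1 = 2 * 1 :> int)// -mulrDr intrM mulrC.
by apply: itv_bndbnd_setU; rewrite bnd_simp ler_pM2r ?exprz_gt0// ler_int lerDl.
Qed.

End dyadic_grid.

(* Main.v *)
(** The dyadic averages of [f] on the tree of subintervals of [J] form a martingale.

  From (2) to (1): on a large [[-2^K, 2^K[], [f] is replaced by its averages over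
  short intervals, minus its mean over each half; the error has small
  oscillation everywhere.  The resulting step function is a combination of
  indicators of dyadic intervals, and an indicator is a BMO limit of smooth bumps
  supported in its interval, by averaging bumps that rise at widely separated
  scales.

  From (2) to (3): a dyadic John-Nirenberg inequality, by a stopping-time argument,
  bounds the energy of a tree-convex family of intervals by the square of the
  largest oscillation on the family.

  From (3) to (2): Cauchy-Schwarz on the martingale, together with its L^1
  convergence.  Smallness of the energy of long intervals does not control the
  oscillation by itself: the remaining intervals are far, or contained in a fixed
  [[-2^K, 2^K[], where the total energy is finite and is diluted by the length. *)
Require Import Defs.
From mathcomp Require Import all_boot all_order all_algebra.
From mathcomp Require Import all_classical all_reals all_analysis.
From mathcomp Require Import measurable_realfun.
From mathcomp Require Import ring lra zify.

Set Implicit Arguments.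
Unset Strict Implicit.
Unset Printing Implicit Defensive.
Import Order.TTheory GRing.Theory Num.Theory.
Import numFieldNormedType.Exports.

Local Open Scope classical_set_scope.
Local Open Scope ring_scope.

#[local] Hint Extern 0 (measurable (dyadic_interval _)) => exact: measurable_itv : core.

(** * The tree of dyadic intervals *)

Section dyadic_tree.
Variable R : realType.
Local Notation idx := (int * int)%type.
Local Notation D := (@dyadic_interval R).
Implicit Types I J L : idx.

(** Short and far intervals pass to subintervals, long ones to superintervals. The step from
    oscillation to energy uses the convexity common to all three; the return wants every subinterval
    of a given interval, which long intervals do not offer, hence the separate dilution argument.
    The BMO bound enters there: through John-Nirenberg it makes the energy inside the window finite.
    No dyadic interval straddles the origin, so the window is treated as two independent halves.
    Subtracting the mean over each half keeps intervals longer than the window under control: the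
    centered step has L^1 norm at most the length of the half times the oscillation of [f] on it,
    and that half is itself a long interval. Infinite sums are replaced by finite binary trees, with
    bounds independent of the depth. *)

Lemma dyadic_intervalP I (x : R) :
  D I x <-> I.2%:~R <= x * 2 ^ I.1 < I.2%:~R + 1.
Proof.
rewrite /dyadic_interval /= in_itv/= intrD.
have h : (0 : R) < 2 ^ I.1 by rewrite exprz_gt0.
have e : 2 ^ (- I.1) = (2 ^ I.1)^-1 :> R by rewrite invr_expz.
by rewrite e ler_pdivrMr// ltr_pdivlMr.
Qed.

Lemma dyadic_length_gt0 I : 0 < dyadic_length R I.
Proof. by rewrite dyadic_lengthE exprz_gt0. Qed.

Lemma dyadic_length_left I :
  dyadic_length R (dyadic_left I) = dyadic_length R I / 2.
Proof. by rewrite !dyadic_lengthE /= opprD expfzDr// pnatr_eq0. Qed.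

Lemma dyadic_length_right I :
  dyadic_length R (dyadic_right I) = dyadic_length R I / 2.
Proof. by rewrite !dyadic_lengthE /= opprD expfzDr// pnatr_eq0. Qed.

Lemma dyadic_length_halves I :
  dyadic_length R I = dyadic_length R (dyadic_left I) + dyadic_length R (dyadic_right I).
Proof. by rewrite dyadic_length_left dyadic_length_right; field. Qed.

Lemma ler_dyadic_length I J :
  (dyadic_length R I <= dyadic_length R J) = (J.1 <= I.1)%R.
Proof. by rewrite !dyadic_lengthE ler_eXz2l ?ltr1n// lerN2. Qed.

Lemma dyadic_interval_left_end I : D I (I.2%:~R * 2 ^ (- I.1)).
Proof.
apply/dyadic_intervalP.
by rewrite -mulrA -expfzDr// addNr expr0z mulr1 lexx ltrDl ltr01.
Qed.

(** In the scale [2 ^ I.1] both intervals have integer ends, so the strict inequalities through the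
    common point [x] become strict inequalities between integers; rounding them gives the
    inclusion. *)
Lemma dyadic_nested I J x : (J.1 <= I.1)%R -> D I x -> D J x -> D I `<=` D J.
Proof.
move=> JI /dyadic_intervalP /andP[Ix1 Ix2] /dyadic_intervalP /andP[Jx1 Jx2].
have [d dE] : exists d : nat, I.1 = J.1 + d%:Z.
  by exists `|I.1 - J.1|%N; lia.
have E2 y : y * 2 ^ I.1 = y * 2 ^ J.1 * ((2 : int) ^+ d)%:~R :> R.
  by rewrite dE expfzDr// mulrA rmorphXn.
have d0 : (0 : R) < ((2 : int) ^+ d)%:~R by rewrite ltr0z exprn_gt0.
have h1 : (J.2 * 2 ^+ d < I.2 + 1)%R.
  rewrite -(ltr_int R) intrM (le_lt_trans _ (_ : x * 2 ^ I.1 < _))//.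
    by rewrite E2 ler_pM2r.
  by rewrite intrD.
have h2 : (I.2 < (J.2 + 1) * 2 ^+ d)%R.
  by rewrite -(ltr_int R) intrM (le_lt_trans Ix1)// E2 ltr_pM2r// intrD.
move=> y /dyadic_intervalP; rewrite E2 => /andP[y1 y2]; apply/dyadic_intervalP.
rewrite -(ler_pM2r d0) -(ltr_pM2r d0); apply/andP; split.
  by apply: le_trans y1; rewrite -intrM ler_int; lia.
by apply: lt_le_trans y2 _; rewrite -(intrD _ _ 1) -(intrD _ _ 1) -intrM ler_int; lia.
Qed.

Lemma subset_dyadic_length I J :
  D I `<=` D J -> dyadic_length R I <= dyadic_length R J.
Proof.
move=> IJ; rewrite /dyadic_length fine_le//.
- by rewrite /dyadic_interval lebesgue_measure_itv/=; case: ifP.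
- by rewrite /dyadic_interval lebesgue_measure_itv/=; case: ifP.
- by apply: le_measure => //; rewrite inE; exact: measurable_itv.
Qed.

Lemma subset_dyadic_level I J : D I `<=` D J -> (J.1 <= I.1)%R.
Proof. by move/subset_dyadic_length; rewrite ler_dyadic_length. Qed.

Lemma dyadic_trichotomy I J :
  [\/ D I `<=` D J, D J `<=` D I | D I `&` D J = set0].
Proof.
have [[x [Ix Jx]]|/set0P/negP] := pselect (D I `&` D J !=set0); last first.
  by rewrite negbK => /eqP ?; constructor 3.
have [JI|/ltW IJ] := lerP J.1 I.1.
- by constructor 1; exact: dyadic_nested Ix Jx.
- by constructor 2; exact: dyadic_nested Jx Ix.
Qed.

Lemma dyadic_leftS I : D (dyadic_left I) `<=` D I.
Proof. by rewrite [D I]dyadic_halves; exact: subsetUl. Qed.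

Lemma dyadic_rightS I : D (dyadic_right I) `<=` D I.
Proof. by rewrite [D I]dyadic_halves; exact: subsetUr. Qed.

Lemma dyadic_same_level_disjoint I J : I.1 = J.1 -> I != J -> D I `&` D J = set0.
Proof.
move=> IJ1 /eqP IJ; rewrite -subset0 => x [Ix Jx]; apply: IJ.
apply: (@dyadic_interval_inj R); apply/seteqP; split.
  by apply: dyadic_nested Ix Jx; rewrite IJ1.
by apply: dyadic_nested Jx Ix; rewrite IJ1.
Qed.

Lemma dyadic_halves_disjoint I :
  D (dyadic_left I) `&` D (dyadic_right I) = set0.
Proof.
apply: dyadic_same_level_disjoint => //; apply/eqP => -[]; lia.
Qed.

Lemma dyadic_subset_case I J : D I `<=` D J ->
  [\/ I = J, D I `<=` D (dyadic_left J) | D I `<=` D (dyadic_right J)].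
Proof.
move=> IJ; have := subset_dyadic_level IJ; rewrite le_eqVlt => /orP[/eqP e|].
  constructor 1; apply/eqP; apply: contrapT => /negP IJn.
  have Ix := dyadic_interval_left_end I.
  have := dyadic_same_level_disjoint (esym e) IJn.
  by rewrite -subset0 => /(_ _ (conj Ix (IJ _ Ix))).
move=> lv; have Ix := dyadic_interval_left_end I.
have := IJ _ Ix; rewrite [D J]dyadic_halves => -[] Jx.
- by constructor 2; apply: dyadic_nested Ix Jx; rewrite /=; lia.
- by constructor 3; apply: dyadic_nested Ix Jx; rewrite /=; lia.
Qed.

(** Truncates the infinite family of subintervals of [J] to [p] generations, [J] being the first;
    proofs on it are inductions on [p] with [J] arbitrary. *)
Fixpoint dyadic_tree p J : seq idx :=
  if p is p'.+1 then
    J :: dyadic_tree p' (dyadic_left J) ++ dyadic_tree p' (dyadic_right J)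
  else [::].

Lemma dyadic_tree_sub p I J : I \in dyadic_tree p J -> D I `<=` D J.
Proof.
elim: p J => // p IH J; rewrite /= inE mem_cat => /or3P[/eqP->//|/IH h|/IH h].
- exact: subset_trans h (@dyadic_leftS J).
- exact: subset_trans h (@dyadic_rightS J).
Qed.

Lemma mem_dyadic_tree p I J :
  D I `<=` D J -> (I.1 < J.1 + p%:Z)%R -> I \in dyadic_tree p J.
Proof.
elim: p J => [|p IH] J IJ lv.
  by have := subset_dyadic_level IJ; lia.
rewrite /= inE mem_cat; have [->|h|h] := dyadic_subset_case IJ.
- by rewrite eqxx.
- by rewrite (IH _ h) ?orbT//=; lia.
- by rewrite (IH (dyadic_right J) h) ?orbT//=; lia.
Qed.

Lemma dyadic_tree_uniq p J : uniq (dyadic_tree p J).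
Proof.
elim: p J => // p IH J /=; rewrite mem_cat cat_uniq !IH andbT/=.
apply/andP; split.
  apply/negP => /orP[] /dyadic_tree_sub /subset_dyadic_level /=; lia.
apply/hasPn => I Ir; apply/negP => Il.
have /= := dyadic_halves_disjoint J.
have /(dyadic_tree_sub Il) h1 := dyadic_interval_left_end I.
have /(dyadic_tree_sub Ir) h2 := dyadic_interval_left_end I.
by rewrite -subset0 => /(_ _ (conj h1 h2)).
Qed.

Lemma sum_dyadic_treeS (V : nmodType) (w : idx -> V) p J :
  \sum_(I <- dyadic_tree p.+1 J) w I =
  w J + (\sum_(I <- dyadic_tree p (dyadic_left J)) w I +
         \sum_(I <- dyadic_tree p (dyadic_right J)) w I).
Proof. by rewrite big_cons big_cat. Qed.

End dyadic_tree.

(** * Oscillation *)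

Section oscillation.
Variable R : realType.
Local Notation idx := (int * int)%type.
Local Notation D := (@dyadic_interval R).
Local Notation mu := (@lebesgue_measure R).
Local Notation len := (dyadic_length R).
Local Notation mean := (@dyadic_mean R).
Local Notation loc := (locally_integrable [set: R]).
Implicit Types (I J : idx) (f g : R -> R) (c : R).

Definition abs_int f I : R := \int[mu]_(x in D I) `|f x|.

(** Real-valued counterpart of [mean_osc], equal to it for locally integrable [f] by [mean_oscE], so
    that real arithmetic applies. *)
Definition osc f I : R := (len I)^-1 * abs_int (fun x => f x - mean f I) I.

Lemma measurable_dyadic I : measurable (D I).
Proof. exact: measurable_itv. Qed.

Lemma locally_integrable_dyadic f I : loc f -> mu.-integrable (D I) (EFin \o f).
Proof.
move=> [mf _ foo].
set a := I.2%:~R * 2 ^ (- I.1) : R; set b := (I.2 + 1)%:~R * 2 ^ (- I.1) : R.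
apply: (@integrableS _ _ _ mu `[a, b]%classic) => //.
  by move=> x; rewrite /dyadic_interval /= !in_itv/= => /andP[-> /ltW].
apply/integrableP; split; last by apply: foo => //; exact: segment_compact.
by apply/measurable_EFinP; exact: measurable_funTS.
Qed.

Lemma continuous_locally_integrable f : continuous f -> loc f.
Proof.
move=> cf; split; [exact: continuous_measurable_fun|exact: openT|].
move=> K _ cK.
have /integrableP[] : mu.-integrable K (EFin \o f).
  by apply: continuous_compact_integrable => //; exact: continuous_subspaceT.
by [].
Qed.

Lemma locally_integrable_cst c : loc (cst c).
Proof. by apply: continuous_locally_integrable => x; exact: cvg_cst. Qed.

Lemma locally_integrableZ c f : loc f -> loc (fun x => c * f x).
Proof.
move=> [mf oT foo]; split => //; first exact: measurable_funM.
move=> K KT cK; have mK : measurable K by exact: compact_measurable.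
under eq_integral do rewrite normrM EFinM.
rewrite ge0_integralZl//.
- by rewrite lte_mul_pinfty// ?lee_fin//; exact: foo.
- by apply/measurable_EFinP; apply: measurableT_comp => //; exact: measurable_funTS.
Qed.

Lemma locally_integrableB_cst f c : loc f -> loc (fun x => f x - c).
Proof. by move=> lf; apply: (locally_integrableB lf (locally_integrable_cst c)). Qed.

Lemma integrable_abs f I : loc f -> mu.-integrable (D I) (EFin \o (fun x => `|f x|)).
Proof. by move=> lf; apply: integrable_norm; exact: locally_integrable_dyadic. Qed.

Lemma abs_int_ge0 f I : 0 <= abs_int f I.
Proof. exact: Rintegral_ge0. Qed.

Lemma eq_abs_int f g I : (forall x, D I x -> `|f x| = `|g x|) ->
  abs_int f I = abs_int g I.
Proof. by move=> fg; apply: eq_Rintegral => x; rewrite inE => /fg. Qed.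

Lemma abs_int_cst c I : abs_int (cst c) I = `|c| * len I.
Proof. by rewrite /abs_int /= Rintegral_cst. Qed.

Lemma abs_int_le f g I : loc f -> loc g ->
  (forall x, D I x -> `|f x| <= `|g x|) -> abs_int f I <= abs_int g I.
Proof. by move=> lf lg fg; apply: le_Rintegral => //; exact: integrable_abs. Qed.

Lemma abs_intD f g I : loc f -> loc g ->
  abs_int (fun x => f x + g x) I <= abs_int f I + abs_int g I.
Proof.
move=> lf lg; rewrite /abs_int -RintegralD//; [|exact: integrable_abs..].
apply: le_Rintegral => //.
- by apply: integrable_abs; exact: locally_integrableD.
- by apply: (@integrableD _ _ _ mu (D I) _ (EFin \o (fun x => `|f x|)) (EFin \o (fun x => `|g x|)));
    [|exact: integrable_abs..].
- by move=> x _; exact: ler_normD.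
Qed.

Lemma abs_intZ c f I : loc f -> abs_int (fun x => c * f x) I = `|c| * abs_int f I.
Proof.
move=> lf; rewrite /abs_int -RintegralZl//; last exact: integrable_abs.
by apply: eq_Rintegral => x _; rewrite normrM.
Qed.

Lemma Rintegral_halves f I : mu.-integrable (D I) (EFin \o f) ->
  \int[mu]_(x in D I) f x =
  \int[mu]_(x in D (dyadic_left I)) f x + \int[mu]_(x in D (dyadic_right I)) f x.
Proof.
move=> fi; rewrite [D I]dyadic_halves Rintegral_setU//.
- by rewrite -dyadic_halves.
- by apply/disj_setPS; rewrite dyadic_halves_disjoint.
Qed.

Lemma abs_int_halves f I : loc f ->
  abs_int f I = abs_int f (dyadic_left I) + abs_int f (dyadic_right I).
Proof. by move=> lf; apply: Rintegral_halves; exact: integrable_abs. Qed.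

Lemma abs_int_subset f I J : loc f -> D I `<=` D J -> abs_int f I <= abs_int f J.
Proof.
move=> lf IJ; rewrite /abs_int /Rintegral fine_le//.
- by apply: integrable_fin_num => //; exact: integrable_abs.
- by apply: integrable_fin_num => //; exact: integrable_abs.
apply: ge0_subset_integral => //.
by apply: measurable_int; exact: (integrable_abs J lf).
Qed.

(** By nesting, [I] lies in [J], or contains [J] and the part outside contributes nothing, or misses
    [J]. *)
Lemma abs_int_support f I J : loc f ->
  (forall x, D I x -> ~ D J x -> f x = 0) -> abs_int f I <= abs_int f J.
Proof.
move=> lf f0; have [IJ|JI|IJ0] := @dyadic_trichotomy R I J.
- exact: abs_int_subset.
- rewrite /abs_int Rintegral_mkcond [leRHS]Rintegral_mkcond.
  rewrite le_eqVlt; apply/orP; left; apply/eqP; apply: eq_Rintegral => x _.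
  rewrite !patchE; case: ifPn => xI; case: ifPn => // xJ.
  + by rewrite f0 ?normr0//; [exact/set_mem|move/mem_set => h; rewrite h in xJ].
  + by exfalso; move/set_mem/JI/mem_set : xJ => h; rewrite h in xI.
- rewrite (@eq_abs_int f (cst 0)) => [|x Ix].
    by rewrite abs_int_cst normr0 mul0r abs_int_ge0.
  by rewrite f0// => Jx; move: IJ0; rewrite -subset0 => /(_ x (conj Ix Jx)).
Qed.

Lemma dyadic_length_mean f I : len I * mean f I = \int[mu]_(x in D I) f x.
Proof. by rewrite /dyadic_mean mulrA divff ?mul1r// gt_eqF// dyadic_length_gt0. Qed.

Lemma eq_dyadic_mean f g I : (forall x, D I x -> f x = g x) -> mean f I = mean g I.
Proof.
by move=> fg; congr (_ * _); apply: eq_Rintegral => x; rewrite inE => /fg.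
Qed.

Lemma dyadic_meanD f g I : loc f -> loc g ->
  mean (fun x => f x + g x) I = mean f I + mean g I.
Proof.
by move=> lf lg; rewrite /dyadic_mean RintegralD// ?mulrDr//;
  exact: locally_integrable_dyadic.
Qed.

Lemma dyadic_meanZ c f I : loc f -> mean (fun x => c * f x) I = c * mean f I.
Proof.
move=> lf; rewrite /dyadic_mean RintegralZl//; last exact: locally_integrable_dyadic.
exact: mulrCA.
Qed.

Lemma dyadic_mean_cst c I : mean (cst c) I = c.
Proof.
by rewrite /dyadic_mean Rintegral_cst// mulrCA mulVf ?mulr1// gt_eqF// dyadic_length_gt0.
Qed.

Lemma dyadic_mean_halves f I : loc f ->
  mean f I = (mean f (dyadic_left I) + mean f (dyadic_right I)) / 2.
Proof.
move=> lf; have l0 : len I != 0 by rewrite gt_eqF// dyadic_length_gt0.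
apply: (mulfI l0); rewrite dyadic_length_mean Rintegral_halves; last first.
  exact: locally_integrable_dyadic.
rewrite -!dyadic_length_mean dyadic_length_left dyadic_length_right; ring.
Qed.

Lemma dyadic_mean_dist f c I : loc f ->
  len I * `|mean f I - c| <= abs_int (fun x => f x - c) I.
Proof.
move=> lf; have -> : mean f I - c = mean (fun x => f x - c) I.
  by rewrite (dyadic_meanD I lf (locally_integrable_cst (- c))) dyadic_mean_cst.
rewrite -{1}(ger0_norm (ltW (dyadic_length_gt0 R I))) -normrM dyadic_length_mean.
apply: le_normr_Rintegral => //.
by apply: locally_integrable_dyadic; exact: locally_integrableB_cst.
Qed.

Lemma dyadic_length_osc f I : len I * osc f I = abs_int (fun x => f x - mean f I) I.
Proof. by rewrite /osc mulrA divff ?mul1r// gt_eqF// dyadic_length_gt0. Qed.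

Lemma osc_ge0 f I : 0 <= osc f I.
Proof. by rewrite mulr_ge0 ?abs_int_ge0// invr_ge0 ltW// dyadic_length_gt0. Qed.

(** The mean is within a factor 2 of the best constant: replacing [c] by the mean costs
    [len I * |mean f I - c|], itself at most the integral of [|f - c|]. *)
Lemma osc_le_cst f c I : loc f -> len I * osc f I <= 2 * abs_int (fun x => f x - c) I.
Proof.
move=> lf; rewrite dyadic_length_osc.
have := @abs_intD (fun x => f x - c) (cst (c - mean f I)) I
  (locally_integrableB_cst c lf) (locally_integrable_cst _).
under eq_fun do rewrite subrKA.
rewrite abs_int_cst => /le_trans; apply; rewrite distrC mulrC.
by rewrite -[2](natrD _ 1 1) mulrDl mul1r lerD2l dyadic_mean_dist.
Qed.

Lemma osc_leP f I c : osc f I <= c <-> len I * osc f I <= c * len I.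
Proof. by rewrite mulrC ler_pM2r ?dyadic_length_gt0. Qed.

Lemma eq_osc f g c I : (forall x, D I x -> f x = g x + c) -> loc g ->
  osc f I = osc g I.
Proof.
move=> fg lg; congr (_ * _); apply: eq_abs_int => x Ix.
rewrite (eq_dyadic_mean fg) (dyadic_meanD I lg (locally_integrable_cst c)).
by rewrite dyadic_mean_cst fg//; congr `|_|; ring.
Qed.

Lemma oscD f g I : loc f -> loc g ->
  osc (fun x => f x + g x) I <= osc f I + osc g I.
Proof.
move=> lf lg; rewrite /osc -mulrDr ler_pM2l ?invr_gt0 ?dyadic_length_gt0//.
rewrite dyadic_meanD//.
under [X in abs_int X _ <= _]eq_fun do rewrite opprD addrACA.
by apply: abs_intD; exact: locally_integrableB_cst.
Qed.

Lemma oscZ c f I : loc f -> osc (fun x => c * f x) I = `|c| * osc f I.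
Proof.
move=> lf; rewrite /osc dyadic_meanZ// [RHS]mulrCA.
rewrite -(abs_intZ c I (locally_integrableB_cst (mean f I) lf)).
by congr (_ * abs_int _ _); apply/funext => x; rewrite mulrBr.
Qed.

Lemma oscB f g I : loc f -> loc g ->
  osc (fun x => f x - g x) I <= osc f I + osc g I.
Proof.
move=> lf lg; have lNg : loc (fun x => -1 * g x) by exact: locally_integrableZ.
have := oscD I lf lNg; rewrite oscZ// normrN1 mul1r.
by under eq_fun do rewrite mulN1r.
Qed.

Lemma mean_oscE f I : loc f -> mean_osc f I = (osc f I)%:E.
Proof.
move=> lf; have lg : loc (fun x => f x - mean f I) by exact: locally_integrableB_cst.
have fi : (\int[mu]_(x in D I) `|f x - mean f I|%:E)%E \is a fin_num.
  by apply: integrable_fin_num => //; exact: (integrable_abs I lg).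
rewrite /mean_osc /iavg /osc /abs_int EFinM /Rintegral fineK//.
congr (_ * _)%E.
rewrite [mu _](_ : _ = (len I)%:E).
  by rewrite inver gt_eqF// dyadic_length_gt0.
by rewrite /dyadic_length fineK// /dyadic_interval lebesgue_measure_itv/=; case: ifP.
Qed.

Lemma dyadic_jump f I : loc f ->
  `|mean f (dyadic_right I) - mean f (dyadic_left I)| <= 2 * osc f I.
Proof.
move=> lf; have l0 := dyadic_length_gt0 R I.
rewrite -(ler_pM2l l0) mulrCA dyadic_length_osc.
have lg : loc (fun x => f x - mean f I) by exact: locally_integrableB_cst.
rewrite (abs_int_halves I lg).
have := dyadic_mean_dist (mean f I) (dyadic_left I) lf.
have := dyadic_mean_dist (mean f I) (dyadic_right I) lf.
rewrite dyadic_length_left dyadic_length_right.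
set a := mean f (dyadic_left I); set b := mean f (dyadic_right I).
have : `|b - a| <= `|b - mean f I| + `|a - mean f I|.
  by rewrite [X in _ <= _ + X]distrC; apply: le_trans (ler_normD _ _); rewrite subrKA.
move: (abs_int _ _) (abs_int _ _) => A B h1 h2 h3; nra.
Qed.

End oscillation.

(** * Haar energy and oscillation *)

Section haar_energy.
Variable R : realType.
Local Notation idx := (int * int)%type.
Local Notation D := (@dyadic_interval R).
Local Notation mu := (@lebesgue_measure R).
Local Notation len := (dyadic_length R).
Local Notation mean := (@dyadic_mean R).
Local Notation loc := (locally_integrable [set: R]).
Implicit Types (I J L : idx) (f g : R -> R) (c : R) (P : set idx).

Lemma haar_coefE f I : loc f ->
  haar_coef f I = (Num.sqrt (len I))^-1 *
    (\int[mu]_(x in D (dyadic_right I)) f x - \int[mu]_(x in D (dyadic_left I)) f x).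
Proof.
move=> lf.
have ri J : mu.-integrable setT (EFin \o (f \_ (D J))).
  have := locally_integrable_dyadic J lf.
  by rewrite integrable_mkcond// restrict_EFin.
rewrite [X in _ - X]Rintegral_mkcond [X in X - _]Rintegral_mkcond.
rewrite -RintegralB// -RintegralZl//; last first.
  by have := integrableB measurableT (ri (dyadic_right I)) (ri (dyadic_left I)).
apply: eq_Rintegral => x _; rewrite /haar mulrCA; congr (_ * _).
rewrite mulrBr !indicE !patchE.
by case: (_ \in _); case: (_ \in _); rewrite ?mulr1 ?mulr0.
Qed.

Lemma haar_coef_sqr f I : loc f -> haar_coef f I ^+ 2 =
  len I / 4 * (mean f (dyadic_right I) - mean f (dyadic_left I)) ^+ 2.
Proof.
move=> lf; rewrite haar_coefE// -!dyadic_length_mean.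
rewrite dyadic_length_left dyadic_length_right exprMn exprVn.
have l0 := dyadic_length_gt0 R I.
by rewrite sqr_sqrtr ?ltW//; field; rewrite gt_eqF.
Qed.

(** Pythagoras for one martingale step, the mean being the midpoint of the means of the halves. Down
    a tree it trades energy for the variance of the leaf means about any constant [c]. *)
Lemma haar_coef_variance f c I : loc f ->
  haar_coef f I ^+ 2 + len I * (mean f I - c) ^+ 2 =
  len (dyadic_left I) * (mean f (dyadic_left I) - c) ^+ 2 +
  len (dyadic_right I) * (mean f (dyadic_right I) - c) ^+ 2.
Proof.
move=> lf; rewrite haar_coef_sqr// dyadic_length_left dyadic_length_right.
by rewrite (dyadic_mean_halves I lf); field.
Qed.

(** Each half mean deviates from the midpoint by half of the jump, which [dyadic_jump] bounds by
    twice the oscillation. *)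
Lemma dyadic_mean_left_dist f I : loc f ->
  `|mean f (dyadic_left I) - mean f I| <= osc f I.
Proof.
move=> lf; have := dyadic_jump I lf; rewrite (dyadic_mean_halves I lf).
rewrite !ler_norml; lra.
Qed.

Lemma dyadic_mean_right_dist f I : loc f ->
  `|mean f (dyadic_right I) - mean f I| <= osc f I.
Proof.
move=> lf; have := dyadic_jump I lf; rewrite (dyadic_mean_halves I lf).
rewrite !ler_norml; lra.
Qed.

(** Below a member of such a [P], an interval that leaves [P] has no descendant in [P], so its tree
    carries no energy. *)
Definition convex_family P :=
  forall I J L, D I `<=` D J -> D J `<=` D L -> P I -> P L -> P J.

Definition energy_on f P I : R := if I \in P then haar_coef f I ^+ 2 else 0.

Definition tree_energy f P p J : R := \sum_(I <- dyadic_tree p J) energy_on f P I.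

Lemma energy_on_ge0 f P I : 0 <= energy_on f P I.
Proof. by rewrite /energy_on; case: ifP => // _; exact: sqr_ge0. Qed.

Lemma tree_energyS f P p J : tree_energy f P p.+1 J =
  energy_on f P J + (tree_energy f P p (dyadic_left J) +
                     tree_energy f P p (dyadic_right J)).
Proof. exact: sum_dyadic_treeS. Qed.

Lemma tree_energy_out f P p J :
  (forall I, D I `<=` D J -> ~ P I) -> tree_energy f P p J = 0.
Proof.
move=> JP; rewrite /tree_energy big_seq big1// => I /dyadic_tree_sub/JP PI.
by rewrite /energy_on memNset.
Qed.

(** * Dyadic John-Nirenberg estimate *)

Section john_nirenberg.
Variables (f : R -> R) (P : set idx) (e : R).
Hypotheses (lf : loc f) (cP : convex_family P) (e0 : 0 < e).
Hypothesis Pe : forall I, P I -> osc f I <= e.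

Let child_cond I J : P J -> D I `<=` D J ->
  P I \/ forall q, tree_energy f P q I = 0.
Proof.
move=> PJ IJ; have [PI|PI] := pselect (P I); [by left|right => q].
apply: tree_energy_out => L LI PL; apply: PI; exact: (cP LI IJ PL PJ).
Qed.

(* Stopping-time argument: at a node where [|f_I - c|] exceeds [4 e] the energy
   below is paid for by [\int_I |f - c|]; otherwise the variance identity
   passes to the two halves, where [|f_I - c|] is still at most [5 e]. *)
Let stopped_energy p c :
  (forall q, (q <= p)%N -> forall I, tree_energy f P q I <= 40 * e ^+ 2 * len I) ->
  forall I, P I \/ (forall q, tree_energy f P q I = 0) ->
  `|mean f I - c| <= 5 * e ->
  tree_energy f P p I + len I * (mean f I - c) ^+ 2 <=
  25 * e ^+ 2 * len I + 10 * e * abs_int (fun x => f x - c) I.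
Proof.
elim: p => [|p IH] JN I PI Ic.
all: have l0 := dyadic_length_gt0 R I.
all: have A0 := abs_int_ge0 (fun x => f x - c) I.
all: have sq : (mean f I - c) ^+ 2 <= 25 * e ^+ 2
  by rewrite -(@real_normK _ (mean f I - c)) ?num_real//;
     move: (normr_ge0 (mean f I - c)) Ic => h1 h2; nra.
all: have h4 := ler_wpM2l (ltW l0) sq.
all: have h6 := mulr_ge0 (ltW e0) A0.
  rewrite /tree_energy big_nil add0r; lra.
case: PI => [PI|->]; last by rewrite add0r; lra.
have [stop|nstop] := ltrP (4 * e) `|mean f I - c|.
  (* Here 40 is 10 times 4: the energy below [I] is at most [10 * e] times [4 * e * len I], which
     the integral of [|f - c|] over [I] dominates. *)
  have h1 := JN _ (leqnn _) I.
  have h3 : 4 * e * len I <= abs_int (fun x => f x - c) I.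
    apply: le_trans (dyadic_mean_dist c I lf); rewrite mulrC.
    by rewrite ler_wpM2l// ltW.
  have h5 := ler_wpM2l (ltW e0) h3.
  lra.
have el := Pe PI.
have dl := dyadic_mean_left_dist I lf; have dr := dyadic_mean_right_dist I lf.
rewrite tree_energyS /energy_on mem_set// addrAC haar_coef_variance//.
have JN' q : (q <= p)%N -> forall J, tree_energy f P q J <= 40 * e ^+ 2 * len J.
  by move=> qp; apply: JN; exact: leqW.
have hl := IH JN' _ (child_cond PI (@dyadic_leftS R I)).
have hr := IH JN' _ (child_cond PI (@dyadic_rightS R I)).
(* The threshold [4 * e] plus a deviation of at most [e] keeps the halves within [5 * e], the
   invariant of the induction. *)
have bl : `|mean f (dyadic_left I) - c| <= 5 * e.
  by move: dl nstop; rewrite !ler_norml; lra.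
have br : `|mean f (dyadic_right I) - c| <= 5 * e.
  by move: dr nstop; rewrite !ler_norml; lra.
have {}hl := hl bl; have {}hr := hr br.
rewrite (abs_int_halves I (locally_integrableB_cst c lf)).
rewrite (dyadic_length_halves R I); lra.
Qed.

(** Strong induction on the depth, since [stopped_energy] at depth [p] consumes this bound up to
    [p]. At a member [J], taking its mean for [c] turns its own coefficient into the squares at the
    two halves; their bounds sum to [25 + 10 = 35] times [e ^+ 2 * len J], below 40. *)
Lemma john_nirenberg_energy p J : tree_energy f P p J <= 40 * e ^+ 2 * len J.
Proof.
elim/ltn_ind: p J => -[|p] JN J.
  rewrite /tree_energy big_nil !mulr_ge0// ?sqr_ge0// ltW//; exact: dyadic_length_gt0.
have l0 := dyadic_length_gt0 R J.
have lenE := dyadic_length_halves R J.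
rewrite tree_energyS /energy_on.
have [PJ|PJ] := pselect (P J); last first.
  rewrite memNset// add0r lenE mulrDr lerD// JN//.
rewrite mem_set//.
have el := Pe PJ.
have := haar_coef_variance (mean f J) J lf.
rewrite subrr expr0n mulr0 addr0 => varE.
have JN' q : (q <= p)%N -> forall J, tree_energy f P q J <= 40 * e ^+ 2 * len J.
  by move=> qp; apply: JN.
have dl := dyadic_mean_left_dist J lf; have dr := dyadic_mean_right_dist J lf.
have e5 : osc f J <= 5 * e by apply: le_trans el _; rewrite ler_peMl ?ltW// ltr1n.
have {}dl := le_trans dl e5; have {}dr := le_trans dr e5.
have hl := stopped_energy JN' (child_cond PJ (@dyadic_leftS R J)) dl.
have hr := stopped_energy JN' (child_cond PJ (@dyadic_rightS R J)) dr.
have := abs_int_halves J (locally_integrableB_cst (mean f J) lf).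
rewrite -dyadic_length_osc => AE.
have AEe : abs_int (fun x => f x - mean f J) (dyadic_left J) +
   abs_int (fun x => f x - mean f J) (dyadic_right J) <= e * len J.
  by rewrite -AE; apply/osc_leP.
have {}AE := ler_wpM2l (ltW e0) AEe.
have := mulr_ge0 (sqr_ge0 e) (ltW l0).
move: hl hr AE; rewrite varE lenE; lra.
Qed.

End john_nirenberg.

(** [esum] is a supremum over finite sets, and a finite set of subintervals of [J] sits in a tree of
    sufficient depth. *)
Lemma haar_energy_leP f P J c :
  (haar_energy f P J <= c%:E)%E <-> (forall p, tree_energy f P p J <= c * len J).
Proof.
have l0 := dyadic_length_gt0 R J.
have -> : (haar_energy f P J <= c%:E)%E =
   (\esum_(I in [set I | D I `<=` D J] `&` P) ((haar_coef f I) ^+ 2)%:E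
     <= (c * len J)%:E)%E.
  by rewrite /haar_energy lee_pdivrMl// -EFinM mulrC.
have sqE p : (tree_energy f P p J)%:E =
    (\sum_(I \in [set` dyadic_tree p J]) (energy_on f P I)%:E)%E.
  by rewrite -fsbig_seq ?(dyadic_tree_uniq R)// sumEFin.
split=> [h p|h].
  rewrite -lee_fin; apply: le_trans h; rewrite sqE.
  rewrite esum_mkcondr; apply: esum_ge; exists [set` dyadic_tree p J].
    by split=> [|I /=]; [exact: finite_seq|exact: dyadic_tree_sub].
  rewrite le_eqVlt; apply/orP; left; apply/eqP.
  by apply: eq_fsbigr => I _; rewrite /energy_on; case: ifP.
apply: ge_ereal_sup => _ [F [finF FJ] <-].
have [s sF] := (finite_seqP F).1 finF.
(* One more than the largest level difference in [F], since a tree of depth [p] stops at level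
   [J.1 + p - 1]. *)
pose p := (\max_(I <- s) `|(I.1 - J.1)%R|%N).+1.
have Fp I : F I -> (I.1 < J.1 + p%:Z)%R.
  rewrite sF /= => Is; have : (`|(I.1 - J.1)%R|%N < p)%N.
    by rewrite ltnS; exact: (@leq_bigmax_seq _ s xpredT (fun I : idx => `|(I.1 - J.1)%R|%N) I Is isT).
  move: (p) => q; lia.
apply: (@le_trans _ _ (tree_energy f P p J)%:E); last by rewrite lee_fin.
rewrite sqE.
have -> : (\sum_(I \in F) (haar_coef f I ^+ 2)%:E = \sum_(I \in F) (energy_on f P I)%:E)%E.
  by apply: eq_fsbigr => I; rewrite inE => /FJ[_ PI]; rewrite /energy_on mem_set.
apply: lee_fsum_nneg_subset => //; first exact: finite_seq.
- move=> I; rewrite inE => FI; apply/mem_set => /=.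
  by have [IJ _] := FJ _ FI; exact: mem_dyadic_tree IJ (Fp _ FI).
- by move=> I _; rewrite lee_fin energy_on_ge0.
Qed.

End haar_energy.

(** * Uniform continuity near a compact set *)

Section uniform_continuity.
Variable R : realType.

(** Only [x] is confined to [K], because a dyadic interval that meets the support of a function may
    stick out of it. *)
Lemma compact_uniformly_continuous (g : R -> R) (K : set R) (e : R) :
  continuous g -> compact K -> 0 < e ->
  exists2 d : R, 0 < d & forall x y, K x -> `|x - y| < d -> `|g x - g y| < e.
Proof.
move=> cg /compact_near_coveringP cK e0.
have := cK R (0^'+) (fun d x => forall y, `|x - y| < d -> `|g x - g y| < e) _.
have e2 : 0 < e / 2 by rewrite divr_gt0.
case.
  move=> x Kx; have /cvgrPdist_lt/(_ _ e2)/nbhs_ballP[r /= r0 gr] := cg x.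
  have r2 : 0 < r / 2 by rewrite divr_gt0.
  exists (ball x (r / 2), [set d | d < r / 2]).
    by split; [exact: nbhsx_ballx|exact: nbhs_right_lt].
  move=> [x' d] /= [xx' dr] y x'y.
  have gx' : `|g x - g x'| < e / 2.
    by apply: gr; apply: le_ball xx'; lra.
  have gy : `|g x - g y| < e / 2.
    apply: gr; move: xx'; rewrite /ball /= => xx'.
    have := ler_distD x' x y; lra.
  by have := ler_distD (g x) (g x') (g y); rewrite (distrC (g x') (g x)); lra.
move=> b [/= b0 Hb].
exists (b / 2); first by rewrite divr_gt0.
move=> x y Kx; apply: (Hb (b / 2)) => //=; last by rewrite divr_gt0.
by rewrite sub0r normrN gtr0_norm ?divr_gt0//; lra.
Qed.

End uniform_continuity.

(** * Oscillation bounded by energy *)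

Section energy_to_oscillation.
Variable R : realType.
Local Notation idx := (int * int)%type.
Local Notation D := (@dyadic_interval R).
Local Notation mu := (@lebesgue_measure R).
Local Notation len := (dyadic_length R).
Local Notation mean := (@dyadic_mean R).
Local Notation loc := (locally_integrable [set: R]).
Implicit Types (I J L : idx) (f g : R -> R) (c : R) (P : set idx).

Lemma dyadic_interval_dist I (x y : R) : D I x -> D I y -> `|x - y| < len I.
Proof.
have -> : len I = (I.2 + 1)%:~R * 2 ^ (- I.1) - I.2%:~R * 2 ^ (- I.1).
  by rewrite dyadic_lengthE intrD; ring.
rewrite /dyadic_interval /= !in_itv/= ltr_norml; lra.
Qed.

Fixpoint leaf_sum (w : idx -> R) p I : R :=
  if p is p'.+1 then leaf_sum w p' (dyadic_left I) + leaf_sum w p' (dyadic_right I)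
  else w I.

Lemma leaf_sum_le (w v : idx -> R) p J :
  (forall L, v L = v (dyadic_left L) + v (dyadic_right L)) ->
  (forall L, D L `<=` D J -> L.1 = J.1 + p%:Z -> w L <= v L) ->
  leaf_sum w p J <= v J.
Proof.
move=> vE; elim: p J => [|p IH] J wv /=.
  by apply: wv => //; rewrite addr0.
rewrite vE lerD// IH// => L LJ lv; apply: wv.
- exact: subset_trans LJ (@dyadic_leftS R J).
- by rewrite lv /=; lia.
- exact: subset_trans LJ (@dyadic_rightS R J).
- by rewrite lv /=; lia.
Qed.

(** On a leaf [L], [f - c] splits into [f - f_L], small by L^1 convergence, and [f_L - c],
    controlled by the energy. *)
Lemma abs_int_leaf f c p I : loc f ->
  abs_int (fun x => f x - c) I <=
  leaf_sum (fun L => len L * osc f L) p I +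
  leaf_sum (fun L => len L * `|mean f L - c|) p I.
Proof.
move=> lf; elim: p I => [|p IH] I /=.
  rewrite dyadic_length_osc mulrC -abs_int_cst.
  have := @abs_intD R (fun x => f x - mean f I) (cst (mean f I - c)) I
    (locally_integrableB_cst _ lf) (locally_integrable_cst _).
  by under eq_fun do rewrite subrKA.
rewrite (abs_int_halves I (locally_integrableB_cst c lf)) addrACA.
exact: lerD.
Qed.

(** Cauchy-Schwarz in the linearized form [2 * t * a <= t ^+ 2 + a ^+ 2], applied at the leaves:
    unlike a square root it is additive over halves, so the variance identity carries it up the
    tree. *)
Lemma leaf_dist_energy f c t p I : loc f ->
  2 * t * leaf_sum (fun L => len L * `|mean f L - c|) p I <=
  t ^+ 2 * len I + tree_energy f setT p I + len I * (mean f I - c) ^+ 2.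
Proof.
move=> lf; elim: p I => [|p IH] I.
  rewrite /tree_energy big_nil addr0 /=.
  have l0 := dyadic_length_gt0 R I.
  rewrite -(@real_normK _ (mean f I - c)) ?num_real//.
  have := mulr_ge0 (ltW l0) (sqr_ge0 (t - `|mean f I - c|)).
  set a := `|_|; lra.
have := haar_coef_variance c I lf.
have := IH (dyadic_left I); have := IH (dyadic_right I).
rewrite tree_energyS /energy_on mem_set//= (dyadic_length_halves R I).
move: (leaf_sum _ _ _) (leaf_sum _ _ _) (tree_energy _ _ _ _) (tree_energy _ _ _ _) => a b A B.
lra.
Qed.

Lemma exists_pow2_lt c (d : R) : 0 <= c -> 0 < d -> exists p : nat, c / 2 ^+ p < d.
Proof.
move=> c0 d0; have cd : 0 <= c / d by rewrite divr_ge0// ltW.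
exists (Num.bound (c / d)); rewrite ltr_pdivrMr ?exprn_gt0// mulrC -ltr_pdivrMr//.
by apply: lt_trans (archi_boundP cd) _; rewrite -natrX ltr_nat ltn_expl.
Qed.

(** L^1 convergence of the martingale. For [g] continuous and close to [f] in L^1, the oscillation
    of [f] on a leaf is at most twice the sum of the mean of [|f - g|] and the variation of [g],
    which is small on short leaves. *)
Lemma leaf_osc_small f J e : loc f -> 0 < e ->
  exists p, leaf_sum (fun L => len L * osc f L) p J <= e.
Proof.
move=> lf e0; have l0 := dyadic_length_gt0 R J.
have fJ := locally_integrable_dyadic J lf.
have muJ : (mu (D J) < +oo)%E.
  by rewrite /dyadic_interval lebesgue_measure_itv/=; case: ifP => _; rewrite ltry.
have [g_ [cg ig gf]] := approximation_continuous_integrable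
  (measurable_dyadic J) muJ fJ.
have e4 : 0 < e / 4 by rewrite divr_gt0.
have [g cont_g gfe] : exists2 g, continuous g & abs_int (fun x => f x - g x) J <= e / 4.
  have : \forall n \near \oo,
      (\int[mu]_(z in D J) `|(f z - g_ n z)%:E| < (e / 4)%:E)%E.
    apply: (gf [set x | (x < (e / 4)%:E)%E]) => /=.
    have : \forall r \near (0 : R), r < e / 4 by exact: lt_nbhsl.
    by apply: filterS => r /=; rewrite lte_fin.
  move=> [n _ /(_ n (leqnn n)) /= H].
  exists (g_ n); first exact: cg.
  rewrite -lee_fin /abs_int /Rintegral fineK; first exact: ltW.
  rewrite ge0_fin_numE; last exact: integral_ge0.
  by apply: lt_trans H _; rewrite ltry.
have lg : loc (fun x => f x - g x).
  exact: (locally_integrableB lf (continuous_locally_integrable cont_g)).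
(* The closure of [D J], as the half-open interval is not compact. *)
pose K : set R := `[J.2%:~R * 2 ^ (- J.1), (J.2 + 1)%:~R * 2 ^ (- J.1)]%classic.
have eJ : 0 < e / (4 * len J) by rewrite divr_gt0// mulr_gt0.
have [d d0 gd] := compact_uniformly_continuous cont_g
  (@segment_compact _ _ _ : compact K) eJ.
have [p pd] := exists_pow2_lt (ltW l0) d0.
exists p.
have -> : e = 2 * (e / 4 + e / (4 * len J) * len J) by field; rewrite gt_eqF.
apply: (@le_trans _ _ (2 * (abs_int (fun x => f x - g x) J + e / (4 * len J) * len J))).
  apply: (@leaf_sum_le _ (fun L => 2 * (abs_int (fun x => f x - g x) L +
     e / (4 * len J) * len L))) => [L|L LJ lv].
    by rewrite (abs_int_halves L lg) (dyadic_length_halves R L); ring.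
  pose y := L.2%:~R * 2 ^ (- L.1) : R.
  apply: le_trans (osc_le_cst (g y) L lf) _; rewrite ler_pM2l//.
  have := @abs_intD R (fun x => f x - g x) (fun x => g x - g y) L lg
    (locally_integrableB_cst _ (continuous_locally_integrable cont_g)).
  under eq_fun do rewrite subrKA.
  move=> /le_trans; apply; rewrite lerD2l -[X in X * _](ger0_norm (ltW eJ)) -abs_int_cst.
  apply: abs_int_le.
  - by apply: locally_integrableB_cst; exact: continuous_locally_integrable.
  - exact: locally_integrable_cst.
  move=> x Lx; rewrite [leRHS](ger0_norm (ltW eJ)) ltW// gd//.
    by have := LJ _ Lx; rewrite /K /dyadic_interval /= !in_itv/= => /andP[-> /ltW].
  apply: lt_trans (dyadic_interval_dist Lx (dyadic_interval_left_end R L)) _.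
  apply: le_lt_trans pd; rewrite !dyadic_lengthE lv opprD expfzDr ?pnatr_eq0//.
  by rewrite exprnN.
by rewrite ler_pM2l// lerD2r.
Qed.

(** With the mean of [f] on [J] for [c], the last term of [leaf_dist_energy] vanishes, and
    [2 * t ^+ 2 * len J] divided by [2 * t] is [t * len J]. The other leaf sum is below any [e] at a
    suitable depth. *)
Lemma osc_le_energy f t J : loc f -> 0 < t ->
  (forall p, tree_energy f setT p J <= t ^+ 2 * len J) -> osc f J <= t.
Proof.
move=> lf t0 en; apply/osc_leP; rewrite dyadic_length_osc.
apply/ler_addgt0Pr => e e0; have [p pe] := leaf_osc_small J lf e0.
apply: le_trans (abs_int_leaf (mean f J) p J lf) _; rewrite addrC lerD//.
have := leaf_dist_energy (mean f J) t p J lf; have := en p.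
rewrite subrr expr0n mulr0 addr0.
move: (leaf_sum _ _ _) (tree_energy _ _ _ _) => a A h1 h2.
by rewrite -(ler_pM2l (_ : 0 < 2 * t)) ?mulr_gt0//; lra.
Qed.

End energy_to_oscillation.

(** * Smooth bumps *)

Section smooth_bump.
Variable R : realType.
Local Notation idx := (int * int)%type.
Local Notation D := (@dyadic_interval R).
Local Notation mu := (@lebesgue_measure R).
Local Notation len := (dyadic_length R).
Local Notation loc := (locally_integrable [set: R]).

(** All powers [k] are included so that derivatives stay in the span of the family: [flat k] has
    derivative [flat (k+2) - k flat (k+1)]. *)
Definition flat (k : nat) (x : R) : R :=
  if 0 < x then x^-1 ^+ k * expR (- x^-1) else 0.

(** Raise [s <= expR s], with [s = t / m], to the power [m]. *)
Lemma expR_pow_bound (m : nat) (t : R) : 0 < t -> t ^+ m * expR (- t) <= m%:R ^+ m.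
Proof.
case: m => [|m] t0; first by rewrite !expr0 mul1r -expR0 ler_expR oppr_le0 ltW.
have m0 : (0 : R) < m.+1%:R by rewrite ltr0n.
have tm : t / m.+1%:R <= expR (t / m.+1%:R).
  by apply: le_trans (expR_ge1Dx _); rewrite lerDr.
have tm' : (t / m.+1%:R) ^+ m.+1 <= expR t.
  rewrite -[X in _ <= expR X](divfK (lt0r_neq0 m0)) expRM_natr.
  by rewrite lerXn2r// ?nnegrE ?expR_ge0// divr_ge0// ltW.
rewrite expRN ler_pdivrMr ?expR_gt0//.
by rewrite -ler_pdivrMl ?exprn_gt0// mulrC -expr_div_n.
Qed.

(** For [h > 0] and [t = 1/h], the ratio of [flat k h] to [h ^+ 2] is [t ^+ (k+2) * expR (- t)]. A
    quadratic bound is what yields the derivative 0 at the origin. *)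
Lemma flat_le_sqr k (h : R) : `|flat k h| <= k.+2%:R ^+ k.+2 * h ^+ 2.
Proof.
rewrite /flat; case: ltP => h0; last by rewrite normr0 mulr_ge0 ?sqr_ge0 ?exprn_ge0.
have hV : 0 < h^-1 by rewrite invr_gt0.
rewrite ger0_norm; last by rewrite mulr_ge0 ?expR_ge0// exprn_ge0// ltW.
rewrite -ler_pdivrMr ?exprn_gt0// mulrAC -exprVn -exprD addn2.
exact: expR_pow_bound.
Qed.

Lemma is_derive_sqr_bound (f : R -> R) (C : R) :
  (forall h, `|f h| <= C * h ^+ 2) -> is_derive (0 : R) 1 f 0.
Proof.
move=> fC.
have f0 : f 0 = 0.
  by apply/eqP; rewrite -normr_le0; have := fC 0; rewrite expr0n mulr0.
have lim0 : h^-1 *: ((f \o shift 0) (h *: (1 : R)) - f 0) @[h --> 0^'] --> (0 : R).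
  apply/cvgr0Pnorm_lt => e e0.
  have C0 : 0 <= C by have := fC 1; rewrite expr1n mulr1; apply: le_trans.
  have C1 : 0 < C + 1 by rewrite ltr_pwDr.
  near=> h.
  have h0 : h != 0 by near: h; exact: nbhs_dnbhs_neq.
  rewrite /= addr0 f0 subr0 /GRing.scale /= mulr1 normrM normfV.
  rewrite mulrC ltr_pdivrMr ?normr_gt0//; apply: le_lt_trans (fC h) _.
  rewrite -real_normK ?num_real// expr2 mulrA ltr_pM2r ?normr_gt0//.
  have : `|h| < e / (C + 1).
    near: h; apply: dnbhs0_lt; exact: divr_gt0.
  rewrite ltr_pdivlMr//; apply: le_lt_trans.
  by rewrite mulrC ler_wpM2l// lerDl.
split; first by apply/cvg_ex; exists 0.
exact: cvg_lim lim0.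
Unshelve. all: by end_near. Qed.

Lemma is_derive_flat k (x : R) :
  is_derive x 1 (flat k) (flat k.+2 x - k%:R * flat k.+1 x).
Proof.
have [x0|x0|x0] := ltgtP x 0.
- have -> : flat k.+2 x - k%:R * flat k.+1 x = 0.
    by rewrite /flat ltNge (ltW x0)/= mulr0 subr0.
  apply: (@near_eq_is_derive _ _ _ (cst 0)).
  near=> y; rewrite /flat ltNge ltW//.
  by near: y; exact: lt_nbhsl.
- have xn0 : x != 0 by rewrite gt_eqF.
  apply: (@near_eq_is_derive _ _ _ (fun y : R => y^-1 ^+ k * expR (- y^-1) : R)).
    near=> y; rewrite /flat ifT//.
    by near: y; exact: lt_nbhsr.
  have dV : is_derive x 1 (fun y : R => y^-1) (- x^-1 ^+ 2).
    have := @is_deriveV _ id x 1 1 xn0 (is_derive_id _ _).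
    by rewrite /GRing.scale /= mulr1 exprVn.
  have dX : is_derive x 1 (fun y : R => y^-1 ^+ k) (- k%:R * x^-1 ^+ k.+1).
    have -> : (fun y : R => y^-1 ^+ k) = (fun y : R => y^-1) ^+ k.
      by apply/funext => y; rewrite exprfctE.
    apply: (is_derive_eq (is_deriveX k dV)); rewrite /GRing.scale /=.
    by case: (k) => [|j]; rewrite ?mul0r ?oppr0 ?mul0r//= !exprS expr0; ring.
  have dE : is_derive x 1 (fun y : R => expR (- y^-1)) (expR (- x^-1) * x^-1 ^+ 2).
    have := @is_derive1_comp _ expR (fun y : R => - y^-1) x _ _
      (is_derive_expR (- x^-1)) (is_deriveN dV).
    by rewrite opprK.
  apply: (is_derive_eq (is_deriveM dX dE)).
  rewrite /flat x0 /GRing.scale /= !exprS; ring.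
- rewrite x0 /flat ltxx mulr0 subr0.
  exact: is_derive_sqr_bound (flat_le_sqr k).
Unshelve. all: by end_near. Qed.

(** A syntactic class closed under derivation, so that derivatives of all orders exist by iterating
    a single step. *)
Inductive smooth_expr : (R -> R) -> Prop :=
| smooth_flat k c d : smooth_expr (fun x => flat k (c * x + d))
| smooth_scale c f : smooth_expr f -> smooth_expr (fun x => c * f x)
| smooth_add f g : smooth_expr f -> smooth_expr g -> smooth_expr (fun x => f x + g x)
| smooth_mul f g : smooth_expr f -> smooth_expr g -> smooth_expr (fun x => f x * g x).

Lemma smooth_expr_derive f : smooth_expr f ->
  exists2 f', smooth_expr f' & forall x : R, is_derive x 1 f (f' x).
Proof.
elim=> {f} [k c d|c f _ [f' sf' df]|f g _ [f' sf' df] _ [g' sg' dg]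
           |f g sf [f' sf' df] sg [g' sg' dg]].
- exists (fun x => c * (flat k.+2 (c * x + d) + (- k%:R) * flat k.+1 (c * x + d))).
    by do ?constructor.
  move=> x.
  have dl : is_derive x 1 (fun y : R => c * y + d) c.
    have := is_deriveD (is_deriveZ c (is_derive_id x (1 : R))) (is_derive_cst d x (1 : R)).
    by move=> /is_derive_eq; apply; rewrite addr0 /GRing.scale /= mulr1.
  have := @is_derive1_comp _ (flat k) (fun y : R => c * y + d) x _ _
    (is_derive_flat k (c * x + d)) dl.
  by move=> /is_derive_eq; apply; ring.
- by exists (fun x => c * f' x); [constructor|move=> x; apply: is_deriveZ].
- by exists (fun x => f' x + g' x); [constructor|move=> x; apply: is_deriveD].
- exists (fun x => f x * g' x + g x * f' x); first by do ?constructor.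
  by move=> x; apply: is_deriveM.
Qed.

Lemma smooth_expr_derive1n f n : smooth_expr f -> smooth_expr (derive1n n f).
Proof.
move=> sf; elim: n => // n IH; have [g sg dg] := smooth_expr_derive IH.
rewrite derive1nS (_ : derive1 _ = g)//; apply/funext => x.
by rewrite derive1E; case: (dg x).
Qed.

Lemma smooth_expr_derivable f n (x : R) : smooth_expr f -> derivable (derive1n n f) x 1.
Proof. by move=> /(smooth_expr_derive1n n)/smooth_expr_derive[g _ /(_ x)[]]. Qed.

Lemma smooth_expr_continuous f : smooth_expr f -> continuous f.
Proof.
move=> /smooth_expr_derive[g _ dg] x.
by apply/differentiable_continuous/derivable1_diffP; case: (dg x).
Qed.

(** Between the ends [a] and [b] of [J], [exp(-(1/(x-a) + 1/(b-x))/(n+1))] tends to 1 pointwise and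
    vanishes flatly at both ends; dominated convergence makes it close to the indicator in L^1. *)
Lemma smooth_bump (J : idx) (e : R) : 0 < e ->
  exists2 g, smooth_expr g &
    [/\ forall x, 0 <= g x <= 1, forall x, ~ D J x -> g x = 0 &
        abs_int (fun x => \1_(D J) x - g x) J <= e].
Proof.
move=> e0.
pose a := J.2%:~R * 2 ^ (- J.1) : R; pose b := (J.2 + 1)%:~R * 2 ^ (- J.1) : R.
have DJ x : D J x <-> a <= x < b by rewrite /dyadic_interval /= in_itv.
have ab : a < b by exact: dyadic_interval_lt.
pose g n x := flat 0 (n.+1%:R * x + - (n.+1%:R * a)) *
              flat 0 (- n.+1%:R * x + n.+1%:R * b).
have sg n : smooth_expr (g n) by do ?constructor.
have gE n x : g n x = flat 0 (n.+1%:R * (x - a)) * flat 0 (n.+1%:R * (b - x)).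
  by rewrite /g; congr (flat _ _ * flat _ _); ring.
have n0 n : (0 : R) < n.+1%:R by rewrite ltr0n.
have g_in n x : a < x < b ->
    g n x = expR (- ((x - a)^-1 + (b - x)^-1) / n.+1%:R).
  move=> /andP[ax xb]; rewrite gE /flat.
  by rewrite !mulr_gt0 ?subr_gt0// !expr0 !mul1r -expRD !invfM; congr expR; ring.
have g_out n x : ~ (a < x < b) -> g n x = 0.
  move=> axb; rewrite gE /flat !pmulr_rgt0// !subr_gt0.
  case: ltP => ax; rewrite ?mul0r//; case: ltP => xb; rewrite ?mulr0//.
  by exfalso; apply: axb; rewrite ax xb.
have g01 n x : 0 <= g n x <= 1.
  have [axb|/g_out->] := pselect (a < x < b); last by rewrite lexx ler01.
  rewrite g_in// expR_ge0 -expR0 ler_expR mulNr oppr_le0.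
  by case/andP: axb => ax xb; rewrite divr_ge0// addr_ge0// invr_ge0 subr_ge0 ltW.
have gJ n x : ~ D J x -> g n x = 0.
  by move=> nJ; apply: g_out => /andP[/ltW ax xb]; apply: nJ; apply/DJ; rewrite ax xb.
have cvg_g x : a < x < b -> g n x @[n --> \oo] --> (1 : R).
  move=> axb; pose C := (x - a)^-1 + (b - x)^-1.
  have hC : (1 - C * n.+1%:R^-1) @[n --> \oo] --> (1 - C * 0 : R).
    apply: cvgB; first exact: cvg_cst.
    by apply: cvgM; [exact: cvg_cst|exact: cvg_harmonic].
  rewrite mulr0 subr0 in hC.
  apply: (squeeze_cvgr _ hC (@cvg_cst _ (1 : R) _ _ _)); near=> n.
  rewrite (andP (g01 n x)).2 andbT g_in// mulNr.
  exact: expR_ge1Dx.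
have mg n : measurable_fun setT (g n).
  by apply: continuous_measurable_fun; exact: smooth_expr_continuous.
have [] := @dominated_convergence _ _ _ mu (D J) _
  (fun n x => (1 - g n x)%:E) (cst 0%E) (cst 1%E) => //.
- move=> n; apply/measurable_EFinP; apply: measurable_funTS.
  by apply: measurable_funB => //; exact: mg.
(* [a] belongs to the half-open interval but every [g n] vanishes there: convergence holds off this
   null set. *)
- exists [set a]; split; [exact: measurable_set1|exact: lebesgue_measure_set1|].
  move=> x /= /not_implyP[/DJ /andP[ax xb]] nc; apply: contrapT => xa; apply: nc.
  apply: cvg_EFin; first by apply: nearW.
  have axb : a < x < b by rewrite xb andbT lt_neqAle ax andbT eq_sym; apply/eqP.
  have h : (1 - g n x) @[n --> \oo] --> (1 - 1 : R).
    by apply: cvgB; [exact: cvg_cst|exact: cvg_g].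
  by rewrite subrr in h; exact: h.
- exact: (locally_integrable_dyadic J (locally_integrable_cst 1)).
- apply/aeW => x n Jx /=; rewrite lee_fin ger0_norm ?lerBlDr ?lerDl ?subr_ge0;
  by case/andP: (g01 n x).
move=> _ _; rewrite integral0 => H.
have : \forall n \near \oo, (\int[mu]_(x in D J) (1 - g n x)%:E < e%:E)%E.
  apply: (H [set x | (x < e%:E)%E]) => /=.
  have : \forall r \near (0 : R), r < e by exact: lt_nbhsl.
  by apply: filterS => r /=; rewrite lte_fin.
move=> [n _ /(_ n (leqnn n)) /= Hn]; exists (g n) => //; split => //; [exact: gJ|].
have -> : abs_int (fun x => \1_(D J) x - g n x) J = \int[mu]_(x in D J) (1 - g n x).
  apply: eq_Rintegral => x xJ; rewrite indicE xJ ger0_norm// subr_ge0.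
  by case/andP: (g01 n x).
have i0 : (0 <= \int[mu]_(x in D J) (1 - g n x)%:E)%E.
  by apply: integral_ge0 => x _; rewrite lee_fin subr_ge0; case/andP: (g01 n x).
rewrite -lee_fin /Rintegral fineK ?ltW// ge0_fin_numE//.
by apply: lt_trans Hn _; rewrite ltry.
Unshelve. all: by end_near. Qed.

End smooth_bump.

(** * Approximation in BMO *)

Section approximation.
Variable R : realType.
Local Notation idx := (int * int)%type.
Local Notation D := (@dyadic_interval R).
Local Notation mu := (@lebesgue_measure R).
Local Notation len := (dyadic_length R).
Local Notation mean := (@dyadic_mean R).
Local Notation loc := (locally_integrable [set: R]).
Implicit Types (I J L : idx) (f g : R -> R) (c e : R).

Lemma osc_le_bound f c e I : loc f ->
  (forall x, D I x -> `|f x - c| <= e) -> osc f I <= 2 * e.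
Proof.
move=> lf fe; apply/osc_leP; apply: le_trans (osc_le_cst c I lf) _.
have e0 : 0 <= e by apply: le_trans (fe _ (dyadic_interval_left_end R I)).
rewrite -mulrA ler_pM2l// -[X in X * _](ger0_norm e0) -abs_int_cst.
apply: abs_int_le; [exact: locally_integrableB_cst|exact: locally_integrable_cst|].
by move=> x Ix; rewrite [leRHS](ger0_norm e0) fe.
Qed.

Lemma locally_integrable_dyadic_indic J : loc \1_(D J).
Proof. by apply: locally_integrable_indic; [exact: openT|exact: measurable_itv]. Qed.

Lemma smooth_expr_locally_integrable f : smooth_expr f -> loc f.
Proof. by move=> /smooth_expr_continuous; exact: continuous_locally_integrable. Qed.

(** Uniform continuity handles the intervals meeting [[-M, M]]; on the others [g] vanishes. *)
Lemma continuous_osc_short g (M e : R) : continuous g ->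
  (forall x, M <= `|x| -> g x = 0) -> 0 < e ->
  exists2 d : R, 0 < d & forall I, len I < d -> osc g I <= e.
Proof.
move=> cg gM e0; have lg := continuous_locally_integrable cg.
have e2 : 0 < e / 2 by rewrite divr_gt0.
have [d d0 gd] := compact_uniformly_continuous cg (@segment_compact _ (- M) M) e2.
exists d => // I Id; rewrite -(divfK (_ : 2 != 0) e)// mulrC.
have [[x0 [Ix0 x0M]]|nI] := pselect (exists x, D I x /\ `|x| <= M).
  apply: (osc_le_bound (c := g x0)) => // x Ix; rewrite distrC ltW// gd//.
    by rewrite /= in_itv/= -ler_norml.
  by apply: lt_trans Id; exact: dyadic_interval_dist.
apply: (osc_le_bound (c := 0)) => // x Ix; rewrite subr0 gM ?normr0 1?ltW//.
by rewrite ltNge; apply/negP => xM; apply: nI; exists x.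
Qed.

Definition compact_smooth g := smooth_expr g /\ exists M, forall x, M <= `|x| -> g x = 0.

Lemma compact_smoothD f g : compact_smooth f -> compact_smooth g -> compact_smooth (fun x => f x + g x).
Proof.
move=> [sf [M fM]] [sg [N gN]]; split; first exact: smooth_add.
by exists (Num.max M N) => x; rewrite ge_max => /andP[/fM-> /gN->]; rewrite addr0.
Qed.

Lemma compact_smoothZ c f : compact_smooth f -> compact_smooth (fun x => c * f x).
Proof.
move=> [sf [M fM]]; split; first exact: smooth_scale.
by exists M => x /fM->; rewrite mulr0.
Qed.

Lemma smooth_expr_compact J g : smooth_expr g -> (forall x, ~ D J x -> g x = 0) -> compact_smooth g.
Proof.
move=> sg gJ; split => //.
pose a := J.2%:~R * 2 ^ (- J.1) : R; pose b := (J.2 + 1)%:~R * 2 ^ (- J.1) : R.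
exists (`|a| + `|b| + 1) => x xM; apply: gJ.
rewrite /dyadic_interval /= in_itv/= -/a -/b => /andP[ax xb]; move: xM.
have := ler_norm b; have := ler_norm (- a).
rewrite normrN; have := normr_ge0 a; have := normr_ge0 b.
have [x0|x0] := lerP 0 x; [rewrite (ger0_norm x0)|rewrite (ltr0_norm x0)]; lra.
Qed.

Definition approximable f := forall e, 0 < e ->
  exists2 g, compact_smooth g & forall I, osc (fun x => f x - g x) I <= e.

Lemma compact_smooth_locally_integrable g : compact_smooth g -> loc g.
Proof. by move=> [/smooth_expr_locally_integrable]. Qed.

Lemma approximableD f g : loc f -> loc g -> approximable f -> approximable g ->
  approximable (fun x => f x + g x).
Proof.
move=> lf lg af ag e e0; have e2 : 0 < e / 2 by rewrite divr_gt0.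
have [f' bf ff'] := af _ e2; have [g' bg gg'] := ag _ e2.
exists (fun x => f' x + g' x); first exact: compact_smoothD.
move=> I; under eq_fun do rewrite opprD addrACA.
rewrite [leRHS]splitr; apply: le_trans (lerD (ff' I) (gg' I)).
by apply: oscD; apply: locally_integrableB => //; exact: compact_smooth_locally_integrable.
Qed.

Lemma approximableZ c f : loc f -> approximable f -> approximable (fun x => c * f x).
Proof.
move=> lf af e e0.
have c1 : 0 < `|c| + 1 by rewrite ltr_wpDl.
have [g bg fg] := af _ (divr_gt0 e0 c1).
exists (fun x => c * g x); first exact: compact_smoothZ.
move=> I; under eq_fun do rewrite -mulrBr.
rewrite oscZ; last by apply: locally_integrableB => //; exact: compact_smooth_locally_integrable.
apply: le_trans (_ : (`|c| + 1) * (e / (`|c| + 1)) <= _).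
  by rewrite ler_pM ?osc_ge0// lerDl.
by rewrite mulrC divfK// gt_eqF.
Qed.

(* Gliding hump: on a given interval all the differences [\1_J - phi_k] but one
   oscillate by at most [e], since each bump [phi_k] is taken so close to [\1_J]
   in L^1 that [\1_J - phi_k] is invisible at the scales where the previous
   bumps start to oscillate. *)
Lemma gliding_hump J e m : 0 < e -> exists2 g, smooth_expr g & exists2 d, 0 < d &
  [/\ forall x, ~ D J x -> g x = 0,
      forall I, len I < d -> osc (fun x => m%:R * \1_(D J) x - g x) I <= m%:R * e &
      forall I, osc (fun x => m%:R * \1_(D J) x - g x) I <= 2 + m%:R * e].
Proof.
move=> e0; have lJ := locally_integrable_dyadic_indic J.
elim: m => [|m [g sg [d d0 [gJ gd g2]]]].
  (* The zero function, in a form that the constructors of [smooth_expr] produce. *)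
  exists (fun x => 0 * flat 0 (0 * x + 0)); first by do ?constructor.
  have -> : (fun x => 0%:R * \1_(D J) x - 0 * flat 0 (0 * x + 0)) = cst (0 : R).
    by apply/funext => x; rewrite !mul0r subr0.
  have osc0 I : osc (cst (0 : R)) I <= 2 * 0.
    apply: (osc_le_bound (c := 0)) => [|x _]; first exact: locally_integrable_cst.
    by rewrite subrr normr0 lexx.
  exists 1 => //; split => [x _|I _|I]; rewrite ?mul0r//.
  - by have := osc0 I; rewrite mulr0.
  - by rewrite addr0; apply: le_trans (osc0 I) _; rewrite mulr0.
have l0 := dyadic_length_gt0 R J.
(* An L^1 error [e / 2 * d], doubled by [osc_le_cst] and divided by a length at least [d], leaves
   [e]. *)
have ed0 : 0 < e / 2 * d by rewrite mulr_gt0// divr_gt0.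
have [phi sphi [phi01 phiJ phi1]] := smooth_bump J ed0.
have bphi := smooth_expr_compact sphi phiJ.
have lphi := compact_smooth_locally_integrable bphi.
have lu : loc (fun x => m%:R * \1_(D J) x - g x).
  apply: locally_integrableB; first exact: locally_integrableZ.
  exact: smooth_expr_locally_integrable.
have lv : loc (fun x => \1_(D J) x - phi x) by exact: locally_integrableB.
have [_ [M phiM]] := bphi.
have [d' d'0 phid'] := continuous_osc_short (smooth_expr_continuous sphi) phiM e0.
exists (fun x => g x + phi x); first exact: smooth_add.
have uv : (fun x => m.+1%:R * \1_(D J) x - (g x + phi x)) =
    (fun x => (m%:R * \1_(D J) x - g x) + (\1_(D J) x - phi x)).
  by apply/funext => x; rewrite -natr1; ring.
rewrite uv.
have v_long I : d <= len I -> osc (fun x => \1_(D J) x - phi x) I <= e.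
  move=> dI; apply/osc_leP; apply: le_trans (osc_le_cst 0 I lv) _.
  rewrite -(@eq_abs_int _ (fun x => \1_(D J) x - phi x)); last by move=> x _; rewrite subr0.
  have : abs_int (fun x => \1_(D J) x - phi x) I <= abs_int (fun x => \1_(D J) x - phi x) J.
    apply: abs_int_support => // x _ nJ; rewrite phiJ// subr0 indicE memNset//.
  have := ler_wpM2l (ltW e0) dI.
  lra.
(* An interval shorter than [J] lies inside [J] or misses it, so the indicator is constant there and
   only [phi] oscillates. *)
have v_short I : len I < Num.min d' (len J) -> osc (fun x => \1_(D J) x - phi x) I <= e.
  rewrite lt_min => /andP[Id' IJ]; apply: le_trans (phid' I Id').
  apply: le_trans (oscB I lJ lphi) _; rewrite gerDr -(mulr0 2).
  have [IJs|JI|IJ0] := dyadic_trichotomy R I J.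
  - apply: (osc_le_bound (c := 1)) => // x /IJs Jx.
    by rewrite indicE mem_set// subrr normr0.
  - by have := subset_dyadic_length JI; rewrite leNgt IJ.
  - apply: (osc_le_bound (c := 0)) => // x Ix.
    rewrite indicE memNset ?subr0 ?normr0// => Jx.
    by move: IJ0; rewrite -subset0 => /(_ x (conj Ix Jx)).
have v2 I : osc (fun x => \1_(D J) x - phi x) I <= 2.
  rewrite -[leRHS]mulr1; apply: (osc_le_bound (c := 0)) => // x _.
  rewrite subr0 indicE; have /andP[p0 p1] := phi01 x.
  have [xJ|xJ] := pselect (D J x); first by rewrite mem_set//= ger0_norm ?subr_ge0// lerBlDr lerDl.
  by rewrite memNset// phiJ// subr0 normr0 ler01.
have mE : m.+1%:R * e = m%:R * e + e by rewrite -natr1 mulrDl mul1r.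
exists (Num.min d (Num.min d' (len J))); first by rewrite !lt_min d0 d'0.
rewrite mE; split => [x nJ|I|I].
- by rewrite gJ// phiJ// addr0.
- rewrite lt_min => /andP[Id Id']; apply: le_trans (oscD I lu lv) _.
  by rewrite lerD ?gd// v_short.
(* From length [d] on, the earlier bumps may cost the 2 and the new one adds [e]; below [d] the
   roles are exchanged. The 2 is never paid twice. *)
- apply: le_trans (oscD I lu lv) _; have [dI|Id] := lerP d (len I).
    by rewrite addrA lerD ?g2// v_long.
  by have := gd I Id; have := v2 I; lra.
Qed.

(** The bound 2 for a single bump does not improve as the bump sharpens. Averaging [m] of them
    divides [2 + m * (e / 2)] by [m], which leaves at most [e] once [m] is at least [4 / e]. *)
Lemma approximable_indic J : approximable \1_(D J).
Proof.
move=> e e0; have e2 : 0 < e / 2 by rewrite divr_gt0.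
have e4 : 0 <= 4 / e by rewrite divr_ge0// ltW.
pose m := (Num.bound (4 / e)).+1.
have m0 : (0 : R) < m%:R by rewrite ltr0n.
have m4 : 4 / e <= m%:R.
  by apply: ltW; apply: lt_le_trans (archi_boundP e4) _; rewrite ler_nat.
have [g sg [d d0 [gJ _ g2]]] := gliding_hump J m e2.
exists (fun x => m%:R^-1 * g x).
  by apply: compact_smoothZ; exact: smooth_expr_compact gJ.
move=> I.
have -> : (fun x => \1_(D J) x - m%:R^-1 * g x) =
    (fun x => m%:R^-1 * (m%:R * \1_(D J) x - g x)).
  by apply/funext => x; rewrite mulrBr mulrA mulVf ?mul1r// gt_eqF.
rewrite oscZ; last first.
  apply: locally_integrableB; last exact: smooth_expr_locally_integrable.
  by apply: locally_integrableZ; exact: locally_integrable_dyadic_indic.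
have mV : (0 : R) <= m%:R^-1 by rewrite invr_ge0 ltW.
rewrite (ger0_norm mV) mulrC ler_pdivrMr//.
apply: le_trans (g2 I) _.
move: m4; rewrite ler_pdivrMr//; lra.
Qed.

(** Conditional expectation of [f] on the [p]-th generation below [J], extended by 0, written as a
    combination of indicators so that approximability passes term by term. *)
Fixpoint step_mean f p J : R -> R :=
  if p is p'.+1 then
    fun x => step_mean f p' (dyadic_left J) x + step_mean f p' (dyadic_right J) x
  else fun x => mean f J * \1_(D J) x.

Lemma step_mean_out f p J x : ~ D J x -> step_mean f p J x = 0.
Proof.
elim: p J => [|p IH] J nJ /=; first by rewrite indicE memNset// mulr0.
by rewrite !IH ?addr0// => Jx; apply: nJ; [exact: dyadic_rightS Jx|exact: dyadic_leftS Jx].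
Qed.

Lemma step_mean_left f p J x : D (dyadic_left J) x ->
  step_mean f p.+1 J x = step_mean f p (dyadic_left J) x.
Proof.
move=> Jx /=; rewrite [X in _ + X]step_mean_out ?addr0// => Jx'.
by have := dyadic_halves_disjoint R J; rewrite -subset0 => /(_ x (conj Jx Jx')).
Qed.

Lemma step_mean_right f p J x : D (dyadic_right J) x ->
  step_mean f p.+1 J x = step_mean f p (dyadic_right J) x.
Proof.
move=> Jx /=; rewrite step_mean_out ?add0r// => Jx'.
by have := dyadic_halves_disjoint R J; rewrite -subset0 => /(_ x (conj Jx' Jx)).
Qed.

Lemma step_mean_locally_integrable f p J : loc (step_mean f p J).
Proof.
elim: p J => [|p IH] J /=; last exact: (locally_integrableD (IH _) (IH _)).
by apply: locally_integrableZ; exact: locally_integrable_dyadic_indic.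
Qed.

Lemma step_mean_approximable f p J : approximable (step_mean f p J).
Proof.
elim: p J => [|p IH] J /=.
  by apply: approximableZ; [exact: locally_integrable_dyadic_indic|exact: approximable_indic].
by apply: approximableD => //; exact: step_mean_locally_integrable.
Qed.

(** Conditional expectation is an L^1 contraction that fixes constants; on each leaf this is
    [dyadic_mean_dist]. *)
Lemma abs_int_step_mean_cst f p J c : loc f ->
  abs_int (fun x => step_mean f p J x - c) J <= abs_int (fun x => f x - c) J.
Proof.
move=> lf; elim: p J => [|p IH] J.
  apply: le_trans (dyadic_mean_dist c J lf); rewrite mulrC -abs_int_cst.
  rewrite le_eqVlt; apply/orP; left; apply/eqP; apply: eq_abs_int => x Jx /=.
  by rewrite indicE mem_set// mulr1.
have lS := step_mean_locally_integrable f p.+1 J.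
rewrite (abs_int_halves J (locally_integrableB_cst c lS)).
rewrite (abs_int_halves J (locally_integrableB_cst c lf)).
apply: lerD; apply: le_trans (IH _).
- rewrite le_eqVlt; apply/orP; left; apply/eqP; apply: eq_abs_int => x Jx.
  by rewrite step_mean_left.
- rewrite le_eqVlt; apply/orP; left; apply/eqP; apply: eq_abs_int => x Jx.
  by rewrite step_mean_right.
Qed.

Lemma abs_int_sub_step_mean f p J e : loc f ->
  (forall I, D I `<=` D J -> (J.1 + p%:Z <= I.1)%R -> osc f I <= e) ->
  abs_int (fun x => f x - step_mean f p J x) J <= e * len J.
Proof.
move=> lf; elim: p J => [|p IH] J fe.
  have := fe J (@subset_refl _ _); rewrite addr0 => /(_ (lexx _))/osc_leP.
  rewrite dyadic_length_osc; apply: le_trans.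
  rewrite le_eqVlt; apply/orP; left; apply/eqP; apply: eq_abs_int => x Jx /=.
  by rewrite indicE mem_set// mulr1.
have lS : loc (fun x => f x - step_mean f p.+1 J x).
  by apply: locally_integrableB => //; exact: step_mean_locally_integrable.
rewrite (abs_int_halves J lS) (dyadic_length_halves R J) mulrDr lerD//.
- rewrite (@eq_abs_int _ _ (fun x => f x - step_mean f p (dyadic_left J) x)).
    apply: IH => I IJ lv; apply: fe; first exact: subset_trans IJ (@dyadic_leftS R J).
    by move: lv => /=; lia.
  by move=> x Jx; rewrite step_mean_left.
- rewrite (@eq_abs_int _ _ (fun x => f x - step_mean f p (dyadic_right J) x)).
    apply: IH => I IJ lv; apply: fe; first exact: subset_trans IJ (@dyadic_rightS R J).
    by move: lv => /=; lia.
  by move=> x Jx; rewrite step_mean_right.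
Qed.

(** Inside a leaf the step function is constant and does not affect the oscillation. A larger [I] is
    a union of leaves, where the L^1 error is bounded leaf by leaf; the factor 2 comes from
    comparing with the constant 0. *)
Lemma osc_sub_step_mean f p J e : loc f ->
  (forall I, D I `<=` D J -> (J.1 + p%:Z <= I.1)%R -> osc f I <= e) ->
  forall I, D I `<=` D J -> osc (fun x => f x - step_mean f p J x) I <= 2 * e.
Proof.
move=> lf; elim: p J => [|p IH] J fe I IJ.
  have fI : osc f I <= e by apply: fe => //; rewrite addr0; exact: subset_dyadic_level IJ.
  have e0 : 0 <= e := le_trans (osc_ge0 f I) fI.
  rewrite (@eq_osc _ _ f (- mean f J))//; first by lra.
  by move=> x /IJ Jx /=; rewrite indicE mem_set// mulr1.
have lS : loc (fun x => f x - step_mean f p.+1 J x).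
  by apply: locally_integrableB => //; exact: step_mean_locally_integrable.
have [->|IJl|IJr] := dyadic_subset_case IJ.
- apply/osc_leP; apply: le_trans (osc_le_cst 0 J lS) _; rewrite -mulrA ler_pM2l//.
  apply: le_trans (abs_int_sub_step_mean lf fe); rewrite le_eqVlt; apply/orP; left.
  by apply/eqP; apply: eq_abs_int => x _; rewrite subr0.
- rewrite (@eq_osc _ _ (fun x => f x - step_mean f p (dyadic_left J) x) 0).
  + apply: IH => // L LJ lv; apply: fe; first exact: subset_trans LJ (@dyadic_leftS R J).
    by move: lv => /=; lia.
  + by move=> x /IJl Jx; rewrite addr0 step_mean_left.
  + by apply: locally_integrableB => //; exact: step_mean_locally_integrable.
- rewrite (@eq_osc _ _ (fun x => f x - step_mean f p (dyadic_right J) x) 0).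
  + apply: IH => // L LJ lv; apply: fe; first exact: subset_trans LJ (@dyadic_rightS R J).
    by move: lv => /=; lia.
  + by move=> x /IJr Jx; rewrite addr0 step_mean_right.
  + by apply: locally_integrableB => //; exact: step_mean_locally_integrable.
Qed.

(** Subtracting the mean brings the L^1 norm down to at most [len J * osc f J], for use on intervals
    longer than [J]; inside [J] a constant does not change oscillations. *)
Definition centered_step f p J x := step_mean f p J x + - mean f J * \1_(D J) x.

Lemma centered_step_locally_integrable f p J : loc (centered_step f p J).
Proof.
apply: locally_integrableD; first exact: step_mean_locally_integrable.
by apply: locally_integrableZ; exact: locally_integrable_dyadic_indic.
Qed.

Lemma centered_step_approximable f p J : approximable (centered_step f p J).
Proof.
apply: approximableD.
- exact: step_mean_locally_integrable.
- by apply: locally_integrableZ; exact: locally_integrable_dyadic_indic.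
- exact: step_mean_approximable.
- by apply: approximableZ; [exact: locally_integrable_dyadic_indic|exact: approximable_indic].
Qed.

Lemma centered_step_out f p J x : ~ D J x -> centered_step f p J x = 0.
Proof.
by move=> nJ; rewrite /centered_step step_mean_out// indicE memNset// mulr0 addr0.
Qed.

Lemma abs_int_centered_step f p J : loc f ->
  abs_int (centered_step f p J) J <= len J * osc f J.
Proof.
move=> lf; rewrite dyadic_length_osc.
apply: le_trans (abs_int_step_mean_cst p J (mean f J) lf).
rewrite le_eqVlt; apply/orP; left; apply/eqP; apply: eq_abs_int => x Jx.
by rewrite /centered_step indicE mem_set// mulr1.
Qed.

Lemma osc_sub_centered_step f p J e : loc f ->
  (forall I, D I `<=` D J -> (J.1 + p%:Z <= I.1)%R -> osc f I <= e) ->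
  forall I, D I `<=` D J -> osc (fun x => f x - centered_step f p J x) I <= 2 * e.
Proof.
move=> lf fe I IJ; rewrite (@eq_osc _ _ (fun x => f x - step_mean f p J x) (mean f J)).
- exact: osc_sub_step_mean.
- by move=> x /IJ Jx; rewrite /centered_step indicE mem_set// mulr1; ring.
- by apply: locally_integrableB => //; exact: step_mean_locally_integrable.
Qed.

End approximation.

(** * The vanishing conditions *)

Section vanishing_conditions.
Variable R : realType.
Local Notation idx := (int * int)%type.
Local Notation D := (@dyadic_interval R).
Local Notation mu := (@lebesgue_measure R).
Local Notation len := (dyadic_length R).
Local Notation mean := (@dyadic_mean R).
Local Notation loc := (locally_integrable [set: R]).
Implicit Types (I J L : idx) (f g : R -> R) (c e : R) (P : set idx).

(** Eventual nonemptiness is required because the supremum of the empty set is [-oo], which would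
    prevent the limit 0. *)
Lemma ereal_sup_cvg0P (F : set_system R) {FF : ProperFilter F}
    (P : R -> set idx) (G : R -> idx -> \bar R) :
  (\forall e \near F, P e !=set0) -> (forall e I, (0 <= G e I)%E) ->
  ereal_sup [set G e I | I in P e] @[e --> F] --> 0%E <->
  (forall c, 0 < c -> \forall e \near F, forall I, P e I -> (G e I <= c%:E)%E).
Proof.
move=> P0 G0; split=> [sup0 c c0|Gc].
  have : \forall e \near F, (ereal_sup [set G e I | I in P e] < c%:E)%E.
    apply: (sup0 [set x | (x < c%:E)%E]) => /=.
    have : \forall r \near (0 : R), r < c by exact: lt_nbhsl.
    by apply: filterS => r /=; rewrite lte_fin.
  apply: filterS => e /ltW H I PI; apply: le_trans H.
  by apply: ereal_sup_ubound; exists I.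
have supc c : 0 < c -> \forall e \near F,
    (0 <= ereal_sup [set G e I | I in P e] <= c%:E)%E.
  move=> c0; have := Gc c c0; move: P0; apply: filterS2 => e [I PI] H.
  apply/andP; split.
    by apply: le_trans (G0 e I) _; apply: ereal_sup_ubound; exists I.
  by apply: ge_ereal_sup => _ [J PJ <-]; exact: H.
apply/fine_cvgP; split.
  apply: filterS (supc 1 ltr01) => e /andP[h0 h1].
  by rewrite ge0_fin_numE//; apply: le_lt_trans h1 _; rewrite ltry.
apply/cvgr0Pnorm_le => c c0; apply: filterS (supc c c0) => e /andP[h0 h1] /=.
rewrite ger0_norm ?fine_ge0// -lee_fin fineK//.
by rewrite ge0_fin_numE//; apply: le_lt_trans h1 _; rewrite ltry.
Qed.

Lemma near_right0P (A : R -> Prop) : (forall e e', e <= e' -> A e' -> A e) ->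
  (\forall e \near 0^'+, A e) <-> exists2 e, 0 < e & A e.
Proof.
move=> mA; split=> [[d /= d0 dA]|[d d0 Ad]].
  exists (d / 2); first by rewrite divr_gt0.
  apply: dA => /=; last by rewrite divr_gt0.
  by rewrite sub0r normrN gtr0_norm ?divr_gt0//; lra.
near=> e; apply: (mA e d) => //; near: e; exact: nbhs_right_ltW.
Unshelve. all: by end_near. Qed.

Lemma near_pinftyP (A : R -> Prop) : (forall e e', e <= e' -> A e -> A e') ->
  (\forall e \near +oo, A e) <-> exists e, A e.
Proof.
move=> mA; split=> [[d [_ dA]]|[d Ad]].
  by exists (d + 1); apply: dA; rewrite ltrDl.
near=> e; apply: (mA d e) => //; near: e; exact: nbhs_pinfty_ge.
Unshelve. all: by end_near. Qed.

Definition osc_small f P c := forall I, P I -> osc f I <= c.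

Definition energy_small f P c := forall p J, tree_energy f P p J <= c * len J.

Lemma short_dyadicS e e' : e <= e' -> short_dyadic e `<=` short_dyadic e'.
Proof. by move=> ee' I /lt_le_trans; apply. Qed.

Lemma long_dyadicS e e' : e <= e' -> long_dyadic e' `<=` long_dyadic e.
Proof. by move=> ee' I; exact: le_lt_trans. Qed.

Lemma far_dyadicS e e' : e <= e' -> far_dyadic e' `<=` far_dyadic e.
Proof.
move=> ee' I; rewrite /far_dyadic /= -!subset0; apply: subset_trans.
apply: setIS => x /=; rewrite !in_itv/= => /andP[x1 x2].
by rewrite (lt_le_trans x2 ee') andbT (le_lt_trans _ x1)// lerN2.
Qed.

Lemma osc_smallS f P P' c : P `<=` P' -> osc_small f P' c -> osc_small f P c.
Proof. by move=> PP' fP I /PP'; exact: fP. Qed.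

Lemma energy_smallS f P P' c : P `<=` P' -> energy_small f P' c -> energy_small f P c.
Proof.
move=> PP' fP p J; apply: le_trans (fP p J); apply: ler_sum => I _.
rewrite /energy_on; case: ifPn => [/set_mem/PP'/mem_set->//|_].
by case: ifP => // _; exact: sqr_ge0.
Qed.

Lemma short_dyadic_nonempty e : 0 < e -> short_dyadic e !=set0.
Proof.
move=> e0; have [p pe] := exists_pow2_lt (@ler01 R) e0.
by exists (p%:Z, 0); rewrite /short_dyadic /= dyadic_lengthE -exprnN -div1r.
Qed.

Lemma exists_pow2_gt c : exists K : nat, c < 2 ^+ K.
Proof.
exists (Num.bound `|c|); apply: le_lt_trans (ler_norm c) _.
by apply: lt_trans (archi_boundP (normr_ge0 c)) _; rewrite -natrX ltr_nat ltn_expl.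
Qed.

Lemma long_dyadic_nonempty e : long_dyadic e !=set0.
Proof.
have [p pe] := exists_pow2_gt e.
by exists (- p%:Z, 0); rewrite /long_dyadic /= dyadic_lengthE opprK.
Qed.

Lemma far_dyadic_nonempty e : far_dyadic e !=set0.
Proof.
have [p pe] := exists_pow2_gt e.
exists (- p%:Z, 1); rewrite /far_dyadic /= -subset0 => x [].
rewrite /dyadic_interval /= !in_itv/= opprK mul1r => /andP[px _] /andP[_ xe].
by have := lt_trans (le_lt_trans px xe) pe; rewrite ltxx.
Qed.

Lemma mean_osc_ge0 f I : (0 <= mean_osc f I)%E.
Proof.
rewrite /mean_osc /iavg mule_ge0//; last exact: integral_ge0.
by rewrite inve_ge0.
Qed.

Lemma haar_energy_ge0 f P J : (0 <= haar_energy f P J)%E.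
Proof.
rewrite /haar_energy mule_ge0//; last by apply: esum_ge0 => I _; rewrite lee_fin sqr_ge0.
by rewrite lee_fin invr_ge0 ltW// dyadic_length_gt0.
Qed.

Lemma osc_cvg0P (F : set_system R) {FF : ProperFilter F} f (P : R -> set idx) :
  loc f -> (\forall e \near F, P e !=set0) ->
  ereal_sup [set mean_osc f I | I in P e] @[e --> F] --> 0%E <->
  (forall c, 0 < c -> \forall e \near F, osc_small f (P e) c).
Proof.
move=> lf P0; rewrite (ereal_sup_cvg0P (G := fun=> mean_osc f) P0); last first.
  by move=> *; exact: mean_osc_ge0.
by split=> h c /h; apply: filterS => e fe I PI; have := fe I PI;
  rewrite mean_oscE// lee_fin.
Qed.

Lemma energy_cvg0P (F : set_system R) {FF : ProperFilter F} f (P : R -> set idx) :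
  ereal_sup [set haar_energy f (P e) J | J in [set: idx]] @[e --> F] --> 0%E <->
  (forall c, 0 < c -> \forall e \near F, energy_small f (P e) c).
Proof.
rewrite (@ereal_sup_cvg0P F _ (fun=> setT) (fun e => haar_energy f (P e))).
- split=> h c /h; apply: filterS => e fe; first by move=> p J; exact: (haar_energy_leP f (P e) J c).1 (fe J Logic.I) p.
  by move=> J _; apply/haar_energy_leP => p; exact: fe.
- by apply: nearW => _; exists (0, 0).
- by move=> *; exact: haar_energy_ge0.
Qed.

Lemma VMO_oscP f : VMO_osc f <->
  [/\ BMO f, forall c, 0 < c -> exists2 e : R, 0 < e & osc_small f (short_dyadic e) c,
      forall c, 0 < c -> exists e : R, osc_small f (long_dyadic e) c &
      forall c, 0 < c -> exists e : R, osc_small f (far_dyadic e) c].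
Proof.
have shortP c : (\forall e \near (0 : R)^'+, osc_small f (short_dyadic e) c) <->
    exists2 e : R, 0 < e & osc_small f (short_dyadic e) c.
  apply: (@near_right0P (fun e => osc_small f (short_dyadic e) c)) => e e' /short_dyadicS.
  exact: osc_smallS.
have longP c : (\forall e \near +oo, osc_small f (long_dyadic (e : R)) c) <->
    exists e : R, osc_small f (long_dyadic e) c.
  apply: (@near_pinftyP (fun e => osc_small f (long_dyadic e) c)) => e e' /long_dyadicS.
  exact: osc_smallS.
have farP c : (\forall e \near +oo, osc_small f (far_dyadic (e : R)) c) <->
    exists e : R, osc_small f (far_dyadic e) c.
  apply: (@near_pinftyP (fun e => osc_small f (far_dyadic e) c)) => e e' /far_dyadicS.
  exact: osc_smallS.
have short0 : \forall e \near (0 : R)^'+, short_dyadic e !=set0.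
  by near=> e; apply: short_dyadic_nonempty; near: e; exact: nbhs_right_gt.
have long0 : \forall e \near +oo, @long_dyadic R e !=set0.
  by apply: nearW => e; exact: long_dyadic_nonempty.
have far0 : \forall e \near +oo, @far_dyadic R e !=set0.
  by apply: nearW => e; exact: far_dyadic_nonempty.
split=> -[bf h1 h2 h3]; have lf := bf.1; split => //.
- by move=> c c0; apply/shortP; exact: (osc_cvg0P lf short0).1 h1 c c0.
- by move=> c c0; apply/longP; exact: (osc_cvg0P lf long0).1 h2 c c0.
- by move=> c c0; apply/farP; exact: (osc_cvg0P lf far0).1 h3 c c0.
- by apply/(osc_cvg0P lf short0) => c c0; apply/shortP; exact: h1.
- by apply/(osc_cvg0P lf long0) => c c0; apply/longP; exact: h2.
- by apply/(osc_cvg0P lf far0) => c c0; apply/farP; exact: h3.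
Unshelve. all: by end_near. Qed.

Lemma VMO_haarP f : VMO_haar f <->
  [/\ BMO f, forall c, 0 < c -> exists2 e : R, 0 < e & energy_small f (short_dyadic e) c,
      forall c, 0 < c -> exists e : R, energy_small f (long_dyadic e) c &
      forall c, 0 < c -> exists e : R, energy_small f (far_dyadic e) c].
Proof.
have shortP c : (\forall e \near (0 : R)^'+, energy_small f (short_dyadic e) c) <->
    exists2 e : R, 0 < e & energy_small f (short_dyadic e) c.
  apply: (@near_right0P (fun e => energy_small f (short_dyadic e) c)) => e e' /short_dyadicS.
  exact: energy_smallS.
have longP c : (\forall e \near +oo, energy_small f (long_dyadic (e : R)) c) <->
    exists e : R, energy_small f (long_dyadic e) c.
  apply: (@near_pinftyP (fun e => energy_small f (long_dyadic e) c)) => e e' /long_dyadicS.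
  exact: energy_smallS.
have farP c : (\forall e \near +oo, energy_small f (far_dyadic (e : R)) c) <->
    exists e : R, energy_small f (far_dyadic e) c.
  apply: (@near_pinftyP (fun e => energy_small f (far_dyadic e) c)) => e e' /far_dyadicS.
  exact: energy_smallS.
split=> -[bf h1 h2 h3]; split => //.
- by move=> c c0; apply/shortP; exact: (energy_cvg0P _ _).1 h1 c c0.
- by move=> c c0; apply/longP; exact: (energy_cvg0P _ _).1 h2 c c0.
- by move=> c c0; apply/farP; exact: (energy_cvg0P _ _).1 h3 c c0.
- by apply/energy_cvg0P => c c0; apply/shortP; exact: h1.
- by apply/energy_cvg0P => c c0; apply/longP; exact: h2.
- by apply/energy_cvg0P => c c0; apply/farP; exact: h3.
Qed.

Lemma osc_le_bmo_norm f c I : loc f -> (bmo_norm f <= c%:E)%E -> osc f I <= c.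
Proof.
move=> lf fc; rewrite -lee_fin -mean_oscE//; apply: le_trans fc.
by apply: ereal_sup_ubound; exists I.
Qed.

Lemma BMO_osc_bound f : BMO f -> exists2 c, 0 < c & forall I, osc f I <= c.
Proof.
move=> [lf fy].
have f0 : (0 <= bmo_norm f)%E.
  by apply: le_trans (mean_osc_ge0 f (0, 0)) _; apply: ereal_sup_ubound; exists (0, 0).
have ffin : bmo_norm f \is a fin_num by rewrite ge0_fin_numE.
exists (fine (bmo_norm f) + 1); first by rewrite ltr_wpDl// fine_ge0.
move=> I; apply: osc_le_bmo_norm => //.
by rewrite EFinD fineK// leeDl.
Qed.

End vanishing_conditions.

(** * The inclusions between the three spaces *)

Section equivalences.
Variable R : realType.
Local Notation idx := (int * int)%type.
Local Notation D := (@dyadic_interval R).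
Local Notation mu := (@lebesgue_measure R).
Local Notation len := (dyadic_length R).
Local Notation mean := (@dyadic_mean R).
Local Notation loc := (locally_integrable [set: R]).
Implicit Types (I J L : idx) (f g : R -> R) (c e : R) (P : set idx).

Lemma convex_short e : convex_family R (short_dyadic e).
Proof.
by move=> I J L _ /subset_dyadic_length JL _; exact: le_lt_trans.
Qed.

Lemma convex_long e : convex_family R (long_dyadic e).
Proof.
by move=> I J L /subset_dyadic_length IJ _ eI _; exact: lt_le_trans IJ.
Qed.

Lemma far_dyadic_subset e I J : D I `<=` D J -> far_dyadic e J -> far_dyadic e I.
Proof.
by move=> IJ; rewrite /far_dyadic /= -!subset0; apply: subset_trans; exact: setSI.
Qed.

Lemma convex_far e : convex_family R (far_dyadic e).
Proof. by move=> I J L _ JL _; exact: far_dyadic_subset JL. Qed.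

(** The threshold avoids a square root: for [e <= 1] and [e <= c / 40],
    [40 * e ^+ 2 <= 40 * e <= c]. *)
Lemma energy_small_of_osc f P c : loc f -> convex_family R P -> 0 < c ->
  osc_small f P (Num.min 1 (c / 40)) -> energy_small f P c.
Proof.
move=> lf cP c0 fP p J; set e := Num.min 1 (c / 40) in fP.
have e0 : 0 < e by rewrite lt_min ltr01 divr_gt0.
apply: le_trans (john_nirenberg_energy lf cP e0 fP p J) _.
rewrite ler_pM2r ?dyadic_length_gt0//.
have e1 : e <= 1 by rewrite ge_min lexx.
have : e <= c / 40 by rewrite ge_min lexx orbT.
nra.
Qed.

Lemma VMO_osc_haar : @VMO_osc R `<=` @VMO_haar R.
Proof.
move=> f /VMO_oscP[bf h1 h2 h3]; apply/VMO_haarP; have lf := bf.1.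
have pos c : 0 < c -> 0 < Num.min 1 (c / 40).
  by move=> c0; rewrite lt_min ltr01 divr_gt0.
split => // c c0.
- have [e e0 fe] := h1 _ (pos c c0); exists e => //.
  by apply: energy_small_of_osc fe => //; exact: convex_short.
- have [e fe] := h2 _ (pos c c0); exists e.
  by apply: energy_small_of_osc fe => //; exact: convex_long.
- have [e fe] := h3 _ (pos c c0); exists e.
  by apply: energy_small_of_osc fe => //; exact: convex_far.
Qed.

(** For [J] in [P] all its subintervals are in [P], so the energy restricted to [P] is the whole
    energy below [J]. Long intervals do not pass to subintervals, whence [osc_long_of_energy]. *)
Lemma osc_small_of_energy f P c : loc f -> 0 < c ->
  (forall I J, D I `<=` D J -> P J -> P I) ->
  energy_small f P (c ^+ 2) -> osc_small f P c.
Proof.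
move=> lf c0 dP fP J PJ; apply: osc_le_energy => // p; apply: le_trans (fP p J).
rewrite le_eqVlt; apply/orP; left; apply/eqP; apply: eq_big_seq => I.
by move=> /(@dyadic_tree_sub R) IJ; rewrite /energy_on !mem_set//; exact: dP PJ.
Qed.

(** The window around the origin comes as two intervals, since no dyadic interval has points on both
    sides of 0. *)
Definition half_dyadic (K : nat) (b : bool) : idx := (- K%:Z, if b then 0 else -1).

Lemma half_dyadic_posP K x : D (half_dyadic K true) x <-> 0 <= x < 2 ^+ K.
Proof.
by rewrite /dyadic_interval /half_dyadic /= in_itv/= opprK mul0r add0r mul1r.
Qed.

Lemma half_dyadic_negP K x : D (half_dyadic K false) x <-> - 2 ^+ K <= x < 0.
Proof.
by rewrite /dyadic_interval /half_dyadic /= in_itv/= opprK mulN1r addNr mul0r.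
Qed.

Lemma half_dyadic_length K b : len (half_dyadic K b) = 2 ^+ K.
Proof. by rewrite dyadic_lengthE opprK. Qed.

Lemma half_dyadic_disjoint K : D (half_dyadic K true) `&` D (half_dyadic K false) = set0.
Proof.
by rewrite -subset0 => x [/half_dyadic_posP/andP[x0 _] /half_dyadic_negP/andP[_]];
  rewrite ltNge x0.
Qed.

(* A dyadic interval does not straddle the origin. *)
Lemma dyadic_half_line I K : len I <= 2 ^+ K -> ~ far_dyadic (2 ^+ K : R) I ->
  exists b, D I `<=` D (half_dyadic K b).
Proof.
rewrite -{1}(half_dyadic_length K true) ler_dyadic_length => lI nI.
have [x [Ix /=]] : D I `&` `]- 2 ^+ K, 2 ^+ K[ !=set0 by apply/set0P/eqP.
rewrite in_itv/= => /andP[x1 x2]; have [x0|x0] := lerP 0 x.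
- by exists true; apply: dyadic_nested Ix _ => //; apply/half_dyadic_posP; rewrite x0.
- by exists false; apply: dyadic_nested Ix _ => //; apply/half_dyadic_negP; rewrite ltW.
Qed.

(** If [J] is not inside [J0], either the two are disjoint or [J0] lies in one half of [J] and the
    other half carries no energy; the induction descends towards [J0]. The bound is absolute rather
    than proportional to [len J], so a large [len J] dilutes it. *)
Lemma tree_energy_within f J0 c :
  (forall p J, D J `<=` D J0 -> tree_energy f [set I | D I `<=` D J0] p J <= c) ->
  0 <= c -> forall p J, tree_energy f [set I | D I `<=` D J0] p J <= c.
Proof.
move=> sub c0; elim=> [|p IH] J; first by rewrite /tree_energy big_nil.
have out L q : D L `&` D J0 = set0 -> tree_energy f [set I | D I `<=` D J0] q L = 0.
  move=> LJ0; apply: tree_energy_out => I IL /= IJ0.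
  have Ix := dyadic_interval_left_end R I.
  by move: LJ0; rewrite -subset0 => /(_ _ (conj (IL _ Ix) (IJ0 _ Ix))).
have [JJ0|nJJ0] := pselect (D J `<=` D J0); first exact: sub.
have [//|J0J|/out->//] := dyadic_trichotomy R J J0.
rewrite tree_energyS /energy_on memNset// add0r.
have := dyadic_halves_disjoint R J; rewrite -subset0 => dis.
have [J0E|J0l|J0r] := dyadic_subset_case J0J.
- by exfalso; apply: nJJ0; rewrite J0E.
- rewrite [X in _ + X]out ?addr0// -subset0 => x [xr /J0l xl].
  exact: dis (conj xl xr).
- rewrite out ?add0r// -subset0 => x [xl /J0r xr].
  exact: dis (conj xl xr).
Qed.

Lemma osc_long_of_energy f c : BMO f -> 0 < c ->
  (exists e : R, energy_small f (long_dyadic e) (c ^+ 2 / 3)) ->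
  (exists e : R, energy_small f (far_dyadic e) (c ^+ 2 / 3)) ->
  exists e : R, osc_small f (long_dyadic e) c.
Proof.
move=> bf c0 [N fN] [r fr]; have lf := bf.1.
have [B B0 fB] := BMO_osc_bound bf.
have [K KN] := exists_pow2_gt (Num.max N r).
have K0 : (0 : R) < 2 ^+ K by rewrite exprn_gt0.
have c3 : 0 < c ^+ 2 / 3 by rewrite divr_gt0// exprn_gt0.
have {}KN : N < 2 ^+ K /\ r < 2 ^+ K by move: KN; rewrite gt_max => /andP.
pose H b : set idx := [set I | D I `<=` D (half_dyadic K b)].
(* John-Nirenberg on the subintervals of one half, with the BMO bound [B] in the role of [e] and
   lengths at most [2 ^+ K]. *)
pose C := 40 * B ^+ 2 * 2 ^+ K.
have C0 : 0 <= C by rewrite !mulr_ge0// ?sqr_ge0// ltW.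
have fH b p J : tree_energy f (H b) p J <= C.
  apply: tree_energy_within => // q L Lb.
  have cH : convex_family R (H b) by move=> I I' I'' _ h _ h'; exact: subset_trans h'.
  have fHB I : H b I -> osc f I <= B by move=> _; exact: fB.
  apply: le_trans (john_nirenberg_energy lf cH B0 fHB q L) _.
  apply: ler_wpM2l; first by rewrite mulr_ge0 ?sqr_ge0.
  by rewrite -(half_dyadic_length K b); exact: subset_dyadic_length.
(* Beyond this length the energy [2 * C] of both halves is at most a third of [c ^+ 2 * len J]; long
   and far intervals account for the other two thirds. *)
exists (2 * C / (c ^+ 2 / 3)) => J.
rewrite /long_dyadic /= ltr_pdivrMr// => JC.
apply: osc_le_energy => // p.
(* The four families may overlap: energies are nonnegative, so covering every interval suffices. *)
have le_sum : tree_energy f setT p J <=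
    tree_energy f (long_dyadic N) p J + tree_energy f (far_dyadic r) p J +
    (tree_energy f (H true) p J + tree_energy f (H false) p J).
  rewrite /tree_energy -!big_split/=; apply: ler_sum => I _.
  have eg P : 0 <= energy_on f P I by exact: energy_on_ge0.
  have inE P : P I -> energy_on f setT I = energy_on f P I.
    by move=> PI; rewrite /energy_on !mem_set.
  have [NI|NI] := ltrP N (len I).
    by rewrite (inE (long_dyadic N))// -addrA lerDl !addr_ge0.
  have [rI|rI] := pselect (far_dyadic r I).
    by rewrite (inE (far_dyadic r))// addrAC lerDr !addr_ge0.
  have nI : ~ far_dyadic (2 ^+ K : R) I.
    by move=> h; apply: rI; apply: far_dyadicS h; rewrite ltW// KN.2.
  have IK : len I <= 2 ^+ K by apply: le_trans NI _; rewrite ltW// KN.1.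
  have [[] Ib] := dyadic_half_line IK nI.
    by rewrite (inE (H true))// addrCA lerDl !addr_ge0.
  by rewrite (inE (H false))// addrA lerDr !addr_ge0.
apply: le_trans le_sum _.
have := fN p J; have := fr p J; have := fH true p J; have := fH false p J.
lra.
Qed.

Lemma VMO_haar_osc : @VMO_haar R `<=` @VMO_osc R.
Proof.
move=> f /VMO_haarP[bf h1 h2 h3]; apply/VMO_oscP; have lf := bf.1.
have c2 c : 0 < c -> 0 < c ^+ 2 by move=> c0; rewrite exprn_gt0.
have c3 c : 0 < c -> 0 < c ^+ 2 / 3 by move=> c0; rewrite divr_gt0 ?c2.
split => // c c0.
- have [e e0 fe] := h1 _ (c2 c c0); exists e => //.
  apply: osc_small_of_energy fe => // I J /subset_dyadic_length IJ.
  exact: le_lt_trans.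
- by apply: osc_long_of_energy => //; [exact: h2 (c3 c c0)|exact: h3 (c3 c c0)].
- have [e fe] := h3 _ (c2 c c0); exists e.
  by apply: osc_small_of_energy fe => // I J; exact: far_dyadic_subset.
Qed.

Lemma compact_smooth_test_function g : compact_smooth g -> test_function g.
Proof.
move=> [sg [M gM]]; split; first by move=> n x; exact: smooth_expr_derivable.
apply: (subclosed_compact (@closed_closure _ _) (@segment_compact _ (- M) M)).
have /closure_id -> : closed (`[- M, M]%classic : set R) by exact: interval_closed.
apply: closureS => x /= /eqP gx; rewrite in_itv/= -ler_norml.
by rewrite leNgt; apply/negP => /ltW/gM.
Qed.

Lemma approximable_of_osc f : loc f ->
  (forall c, 0 < c -> exists2 e : R, 0 < e & osc_small f (short_dyadic e) c) ->
  (forall c, 0 < c -> exists e : R, osc_small f (long_dyadic e) c) ->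
  (forall c, 0 < c -> exists e : R, osc_small f (far_dyadic e) c) ->
  approximable f.
Proof.
(* The error [f - T] costs at most [5 * c = e / 2]: on long intervals [c] for [f] and [4 * c] for
   the two steps, elsewhere less. The other [e / 2] pays for smoothing the steps. *)
move=> lf h1 h2 h3 e e0; pose c := e / 10; have c0 : 0 < c by rewrite divr_gt0.
have [d d0 fd] := h1 c c0; have [N fN] := h2 c c0; have [r fr] := h3 c c0.
have [K KN] := exists_pow2_gt (Num.max N r).
have K0 : (0 : R) < 2 ^+ K by rewrite exprn_gt0.
have {KN}[KN Kr] : N < 2 ^+ K /\ r < 2 ^+ K by move: KN; rewrite gt_max => /andP.
have [p pd] := exists_pow2_lt (ltW K0) d0.
pose T b := centered_step f p (half_dyadic K b).
have lT b : loc (T b) by exact: centered_step_locally_integrable.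
have lTT : loc (fun x => T true x + T false x) by exact: locally_integrableD.
have c2 : 0 < e / 2 by rewrite divr_gt0.
have [g bg Tg] := approximableD (lT true) (lT false)
  (@centered_step_approximable R f p (half_dyadic K true))
  (@centered_step_approximable R f p (half_dyadic K false)) c2.
exists g => // I.
have lg := compact_smooth_locally_integrable bg.
have -> : (fun x => f x - g x) =
    (fun x => (f x - (T true x + T false x)) + (T true x + T false x - g x)).
  by apply/funext => x; rewrite addrA subrK.
rewrite [leRHS]splitr; apply: le_trans (oscD _ _ _) _; [exact: locally_integrableB..|].
apply: lerD => //.
have lfT : loc (fun x => f x - (T true x + T false x)) by exact: locally_integrableB.
have fhalf b : osc f (half_dyadic K b) <= c by apply: fN; rewrite /long_dyadic /= half_dyadic_length.
have ce : 5 * c = e / 2 by rewrite /c; field.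
(* For long [I], each centered step has L^1 norm at most [c * 2 ^+ K], which the length of [I]
   absorbs. *)
have [KI|IK] := lerP (2 ^+ K) (len I).
  have fI : osc f I <= c by apply: fN; exact: lt_le_trans KI.
  have TI b : abs_int (T b) I <= c * len I.
    apply: le_trans (_ : abs_int (T b) (half_dyadic K b) <= _).
      by apply: abs_int_support => // x _; exact: centered_step_out.
    apply: le_trans (abs_int_centered_step p (half_dyadic K b) lf) _.
    rewrite half_dyadic_length mulrC.
    exact: (ler_pM (osc_ge0 _ _) (ltW K0) (fhalf b) KI).
  have TTI : osc (fun x => T true x + T false x) I <= 4 * c.
    apply/osc_leP; apply: le_trans (osc_le_cst 0 I lTT) _.
    rewrite (@eq_abs_int _ _ (fun x => T true x + T false x)); last first.
      by move=> x _; rewrite subr0.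
    have := abs_intD I (lT true) (lT false); have := TI true; have := TI false.
    lra.
  apply: le_trans (oscB I lf lTT) _; apply: le_trans (lerD fI TTI) _.
  by rewrite -ce le_eqVlt; apply/orP; left; apply/eqP; ring.
have [[b Ib]|nIb] := pselect (exists b, D I `<=` D (half_dyadic K b)).
  rewrite (@eq_osc _ _ (fun x => f x - T b x) 0).
  - apply: (@le_trans _ _ (2 * c)); last by lra.
    apply: osc_sub_centered_step Ib => // L _ lv; apply: fd.
    rewrite /short_dyadic /= dyadic_lengthE; apply: le_lt_trans pd.
    rewrite exprnN exprnP -expfzDr ?pnatr_eq0// ler_eXz2l ?ltr1n//.
    by move: lv => /=; lia.
  - move=> x /Ib Kx; rewrite addr0; case: b Ib Kx => Ib Kx.
      rewrite [T false x]centered_step_out ?addr0// => Kx'.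
      by have := half_dyadic_disjoint K; rewrite -subset0 => /(_ x (conj Kx Kx')).
    rewrite [T true x]centered_step_out ?add0r// => Kx'.
    by have := half_dyadic_disjoint K; rewrite -subset0 => /(_ x (conj Kx' Kx)).
  - exact: locally_integrableB.
(* What remains is disjoint from both halves, hence far: the steps vanish on it and [f] itself
   oscillates little. *)
have Iout b x : D I x -> ~ D (half_dyadic K b) x.
  move=> Ix Kx; have [Ib|bI|] := dyadic_trichotomy R I (half_dyadic K b).
  - by apply: nIb; exists b.
  - by have := subset_dyadic_length bI; rewrite half_dyadic_length leNgt IK.
  - by rewrite -subset0 => /(_ x (conj Ix Kx)).
have fI : far_dyadic (2 ^+ K : R) I.
  rewrite /far_dyadic /= -subset0 => x [Ix] /=; rewrite in_itv/= => /andP[x1 x2].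
  have [x0|x0] := lerP 0 x.
    by apply: (Iout true x Ix); apply/half_dyadic_posP; rewrite x0.
  by apply: (Iout false x Ix); apply/half_dyadic_negP; rewrite ltW.
rewrite (@eq_osc _ _ f 0)//.
  have fIc : osc f I <= c by apply: fr; apply: far_dyadicS fI; exact: ltW.
  by apply: le_trans fIc _; rewrite -ce ler_peMl ?ltW// ltr1n.
move=> x Ix; rewrite /T !centered_step_out; [by rewrite addr0 subr0 addr0|exact: Iout..].
Qed.

Lemma VMO_osc_closure : @VMO_osc R `<=` @VMO_closure R.
Proof.
move=> f /VMO_oscP[bf h1 h2 h3]; have lf := bf.1; split => // e e0.
have e2 : 0 < e / 2 by rewrite divr_gt0.
have [g bg fg] := approximable_of_osc lf h1 h2 h3 e2.
exists g; first exact: compact_smooth_test_function.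
have lfg : loc (f \- g) by apply: locally_integrableB => //; exact: compact_smooth_locally_integrable.
apply: (@le_lt_trans _ _ (e / 2)%:E); last by rewrite lte_fin; lra.
by apply: ge_ereal_sup => _ [I _ <-]; rewrite mean_oscE// lee_fin; exact: fg.
Qed.

Lemma test_function_support g : test_function g ->
  continuous g /\ exists2 M, 0 < M & forall x, M <= `|x| -> g x = 0.
Proof.
move=> [dg cg]; split.
  by move=> x; apply/differentiable_continuous/derivable1_diffP; exact: (dg 0%N).
have [M [_ gM]] := compact_bounded cg.
(* [compact_bounded] gives a bound for every radius above [M]; [|M| + 1] is one, and the 2 makes the
   contradiction strict. *)
exists (`|M| + 2); first by rewrite ltr_wpDl.
move=> x xM; apply/eqP; apply: contrapT => /negP gx.
have clx : closure [set x | g x != 0] x by exact: subset_closure.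
have := fun h => gM (`|M| + 1) h x clx.
rewrite (le_lt_trans (ler_norm M)) ?ltrDl// => /(_ isT) h.
by have := le_trans xM h; lra.
Qed.

(** The approximant [g] is continuous with compact support: uniform continuity settles short
    intervals, the finite L^1 norm is diluted on long ones, and [g] vanishes on far ones. *)
Lemma VMO_closure_osc : @VMO_closure R `<=` @VMO_osc R.
Proof.
move=> f [bf cf]; apply/VMO_oscP; have lf := bf.1.
have apx c : 0 < c -> exists g, [/\ continuous g,
    exists2 M, 0 < M & forall x, M <= `|x| -> g x = 0 &
    forall I, osc f I <= c / 2 + osc g I].
  move=> c0; have c2 : 0 < c / 2 by rewrite divr_gt0.
  have [g tg /ltW fg] := cf _ c2; have [cg Mg] := test_function_support tg.
  exists g; split => // I; have lg := continuous_locally_integrable cg.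
  have lfg : loc (f \- g) by exact: locally_integrableB.
  have -> : f = (fun x => (f \- g) x + g x) by apply/funext => x; rewrite /= subrK.
  apply: le_trans (oscD I lfg lg) _; rewrite lerD2r.
  exact: osc_le_bmo_norm.
split => // c c0; have c2 : 0 < c / 2 by rewrite divr_gt0.
- have [g [cg [M M0 gM] fg]] := apx c c0.
  have [d d0 gd] := continuous_osc_short cg gM c2.
  by exists d => // I /gd gI; apply: le_trans (fg I) _; rewrite [leRHS]splitr lerD2l.
- have [g [cg [M M0 gM] fg]] := apx c c0.
  have lg := continuous_locally_integrable cg.
  have [K KM] := exists_pow2_gt M.
  pose C := abs_int g (half_dyadic K true) + abs_int g (half_dyadic K false).
  exists (2 * C / (c / 2)) => I; rewrite /long_dyadic /= ltr_pdivrMr// => IC.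
  apply: le_trans (fg I) _; rewrite [leRHS]splitr lerD2l; apply/osc_leP.
  apply: le_trans (osc_le_cst 0 I lg) _.
  rewrite (@eq_abs_int _ _ g); last by move=> x _; rewrite subr0.
  rewrite [leRHS]mulrC; apply: le_trans (ltW IC); rewrite ler_pM2l//.
  have Ct := abs_int_ge0 g (half_dyadic K true).
  have Cf := abs_int_ge0 g (half_dyadic K false).
  have gK b x : ~ D (half_dyadic K true) x -> ~ D (half_dyadic K false) x -> g x = 0.
    move=> /half_dyadic_posP tx /half_dyadic_negP fx; apply: gM; rewrite leNgt.
    apply/negP; rewrite ltr_norml => /andP[x1 x2].
    have [x0|x0] := lerP 0 x; [apply: tx|apply: fx]; apply/andP; split; lra.
  (* The sign of [I.2] tells on which side of the origin [I] lies, hence which half carries the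
     integral of [|g|] over [I]. *)
  have [I0|I0] := lerP 0 I.2.
    apply: le_trans (_ : abs_int g (half_dyadic K true) <= _); last by rewrite lerDl.
    apply: abs_int_support => // x /dyadic_intervalP/andP[x0 _] nx; apply: gK => //.
    move=> /half_dyadic_negP/andP[_ x0']; have : 0 <= x * 2 ^ I.1.
      by apply: le_trans x0; rewrite ler0z.
    by rewrite pmulr_lge0 ?exprz_gt0// leNgt x0'.
  apply: le_trans (_ : abs_int g (half_dyadic K false) <= _); last by rewrite lerDr.
  apply: abs_int_support => // x /dyadic_intervalP/andP[_ x0] nx; apply: gK => //.
  move=> /half_dyadic_posP/andP[x0' _]; have : x * 2 ^ I.1 < 0.
    by apply: lt_le_trans x0 _; rewrite -(intrD _ _ 1) lerz0; lia.
  by rewrite ltNge mulr_ge0// exprz_ge0.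
- have [g [cg [M M0 gM] fg]] := apx c c0.
  exists M => I; rewrite /far_dyadic /= -subset0 => IM.
  apply: le_trans (fg I) _; rewrite [leRHS]splitr lerD2l.
  apply: (@le_trans _ _ (2 * 0)); last by rewrite mulr0 ltW.
  apply: (osc_le_bound (c := 0)) => [|x Ix]; first exact: continuous_locally_integrable.
  rewrite subr0 gM ?normr0// leNgt; apply/negP => xM.
  by apply: (IM x); split => //; rewrite /= in_itv/= -ltr_norml.
Qed.

End equivalences.

Theorem proposition5p5 (R : realType) :
  @VMO_closure R = @VMO_osc R /\ @VMO_osc R = @VMO_haar R.
Proof.
split; apply/seteqP; split.
- exact: VMO_closure_osc.
- exact: VMO_osc_closure.
- exact: VMO_osc_haar.
- exact: VMO_haar_osc.
Qed.
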